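(* Let $\{\phi_{j\boldsymbol{\gamma}}\}_{j=1}^{\infty}$ be an orthonormal basis of $L^2(F_{\boldsymbol{\gamma}})$, with elements in $\mathcal{L}(F_{\boldsymbol{\gamma}})$, and let $\widetilde{\phi}_{j\boldsymbol{\gamma}}=\phi_{j\boldsymbol{\gamma}}-\sum_{k=1}^p a_{\boldsymbol{\gamma}_k}\langle a_{\boldsymbol{\gamma}_k},\phi_{j\boldsymbol{\gamma}}\rangle_{F_{\boldsymbol{\gamma}}}$ for $j\ge 1$. Then the set of functions $\{\boldsymbol{U}_p K l_{\boldsymbol{\gamma},\boldsymbol{\beta}}\phi_{j\boldsymbol{\gamma}}\}_{j=1}^{\infty}$ forms an orthonormal basis for $L^2(G_{\boldsymbol{\beta}})$. Define, for each $j\ge 1$, $h_{j\boldsymbol{\beta}}=\boldsymbol{U}_p K l_{\boldsymbol{\gamma},\boldsymbol{\beta}}\phi_{j\boldsymbol{\gamma}}$ and $\widetilde{h}_{j\boldsymbol{\beta}}=\boldsymbol{U}_p K l_{\boldsymbol{\gamma},\boldsymbol{\beta}}\widetilde{\phi}_{j\boldsymbol{\gamma}}$. Then the empirical processes $v_{\boldsymbol{\beta},n}(\widetilde{h}_{j\boldsymbol{\beta}})$ and $v_{\boldsymbol{\gamma},n}(\widetilde{\phi}_{j\boldsymbol{\gamma}})$, indexed by $j\ge 1$, have the same limiting distribution as $n\to\infty$ (in the sense of convergence of finite-dimensional distributions over the index $j$) under $G_{\boldsymbol{\beta}}$ and $F_{\boldsymbol{\gamma}}$, respectively, that is, when the first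 is computed from i.i.d. observations $X_1,\dots,X_n\sim G_{\boldsymbol{\beta}}$ and the second from i.i.d. observations $X_1,\dots,X_n\sim F_{\boldsymbol{\gamma}}$.
   Context: All function spaces are real Hilbert spaces. $G_{\boldsymbol{\beta}}$ and $F_{\boldsymbol{\gamma}}$ are continuous distributions with the same support $\mathcal{X}\subseteq\mathbb{R}$ and densities $g_{\boldsymbol{\beta}}, f_{\boldsymbol{\gamma}}$ (positive on $\mathcal{X}$), differentiable in their parameters $\boldsymbol{\beta},\boldsymbol{\gamma}$, which both have dimension $p$; $\boldsymbol{\beta}$ and $\boldsymbol{\gamma}$ are fixed here. For $P\in\{G_{\boldsymbol{\beta}},F_{\boldsymbol{\gamma}}\}$, $\langle h,h'\rangle_P=\int_{\mathcal{X}}h h'\,dP$ is the inner product of $L^2(P)$, $\mathbf{1}$ is the constant function equal to $1$, and $\mathcal{L}(P)=\{h\in L^2(P):\langle h,\mathbf{1}\rangle_P=0\}$. Empirical processes: $v_{\boldsymbol{\beta},n}(h)=\frac{1}{\sqrt n}\sum_{i=1}^n\big[h(X_i)-\mathbb{E}_{G_{\boldsymbol{\beta}}}h(X_i)\big]$ for $h\in L^2(G_{\boldsymbol{\beta}})$, and $v_{\boldsymbol{\gamma},n}(\phi)=\frac{1}{\sqrt n}\sum_{i=1}^n\big[\phi(X_i)-\mathbb{E}_{F_{\boldsymbol{\gamma}}}\phi(X_i)\big]$ for $\phi\in L^2(F_{\boldsymbol{\gamma}})$. Scores: the score functions $\boldsymbol{u}_{\boldsymbol{\beta}}=\nabla_{\boldsymbol{\beta}}\ln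 g_{\boldsymbol{\beta}}$ and $\nabla_{\boldsymbol{\gamma}}\ln f_{\boldsymbol{\gamma}}$ have square-integrable, mean-zero components and invertible Fisher information matrices. The orthonormalized score of $G_{\boldsymbol{\beta}}$ is $\boldsymbol{b}_{\boldsymbol{\beta}}=[b_{\boldsymbol{\beta}_1},\dots,b_{\boldsymbol{\beta}_p}]^T=\Gamma_{\boldsymbol{\beta}}^{-1/2}\boldsymbol{u}_{\boldsymbol{\beta}}$, where $\Gamma_{\boldsymbol{\beta}}=\langle\boldsymbol{u}_{\boldsymbol{\beta}},\boldsymbol{u}_{\boldsymbol{\beta}}^T\rangle_{G_{\boldsymbol{\beta}}}$ and $\Gamma_{\boldsymbol{\beta}}^{-1/2}$ is the principal square root of $\Gamma_{\boldsymbol{\beta}}^{-1}$; the orthonormalized score $\boldsymbol{a}_{\boldsymbol{\gamma}}=[a_{\boldsymbol{\gamma}_1},\dots,a_{\boldsymbol{\gamma}_p}]^T$ of $F_{\boldsymbol{\gamma}}$ is defined in the same way. Operators: $l_{\boldsymbol{\gamma},\boldsymbol{\beta}}(x)=\sqrt{f_{\boldsymbol{\gamma}}(x)/g_{\boldsymbol{\beta}}(x)}$, $x\in\mathcal{X}$, also regarded as the multiplication operator $\phi\mapsto l_{\boldsymbol{\gamma},\boldsymbol{\beta}}\phi$ from $L^2(F_{\boldsymbol{\gamma}})$ to $L^2(G_{\boldsymbol{\beta}})$. On $L^2(G_{\boldsymbol{\beta}})$, $$K\zeta=\zeta-\frac{\langle l_{\boldsymbol{\gamma},\boldsymbol{\beta}}-\mathbf{1},\zeta\rangle_{G_{\boldsymbol{\beta}}}}{1-\langle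 l_{\boldsymbol{\gamma},\boldsymbol{\beta}},\mathbf{1}\rangle_{G_{\boldsymbol{\beta}}}}\,(l_{\boldsymbol{\gamma},\boldsymbol{\beta}}-\mathbf{1}),$$ with $K=I$ (the identity operator) if $l_{\boldsymbol{\gamma},\boldsymbol{\beta}}=\mathbf{1}$ a.e. For unit vectors $b,c\in L^2(G_{\boldsymbol{\beta}})$, $$U_{bc}\zeta=\zeta-\frac{\langle b-c,\zeta\rangle_{G_{\boldsymbol{\beta}}}}{1-\langle b,c\rangle_{G_{\boldsymbol{\beta}}}}\,(b-c),$$ with $U_{bc}=I$ if $b=c$. Set $c_{\lambda_k}=K l_{\boldsymbol{\gamma},\boldsymbol{\beta}}a_{\boldsymbol{\gamma}_k}$ for $k=1,\dots,p$; $\widetilde c_{\lambda_1}=c_{\lambda_1}$; recursively $\widetilde c_{\lambda_k}=U_{b_{\boldsymbol{\beta}_{k-1}}\widetilde c_{\lambda_{k-1}}}\circ\cdots\circ U_{b_{\boldsymbol{\beta}_1}\widetilde c_{\lambda_1}}c_{\lambda_k}$ for $k=2,\dots,p$; and $\boldsymbol{U}_p=U_{b_{\boldsymbol{\beta}_p}\widetilde c_{\lambda_p}}\circ\cdots\circ U_{b_{\boldsymbol{\beta}_1}\widetilde c_{\lambda_1}}$.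
   Formalization: No orthonormal basis of L²(F_γ) lies in L(F_γ), since 1 is orthogonal to L(F_γ). The formal claim treats both consistent readings: a basis of L²(F_γ) gives one of L²(G_β); a basis of L(F_γ) gives one of L(G_β). The limit claim is stated for both. *)

(* Defs.v *)
(* MathComp / MathComp-Analysis *)
From HB Require Import structures.
From mathcomp Require Export all_boot all_order all_algebra.
From mathcomp Require Export all_classical all_reals all_analysis.

Set Implicit Arguments.
Unset Strict Implicit.
Unset Printing Implicit Defensive.

Import Order.TTheory GRing.Theory Num.Theory.
Import numFieldNormedType.Exports.

Local Open Scope classical_set_scope.
Local Open Scope ring_scope.

Section L2.
Context {R : realType}.
Implicit Types (P : probability (measurableTypeR R) R) (h : R -> R).

(* Elements of L^2(P) are represented by functions on R, and are identified
   when they agree P-almost everywhere. The laws P used below are carried by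
   their support X, so that integrals over R and over X coincide. *)
Definition L2 P : set (R -> R) := [set h | h \in Lfun P 2%:E].

Definition inner P h h' : R := \int[P]_x (h x * h' x).

Definition L2_centered P : set (R -> R) :=
  [set h | L2 P h /\ inner P h (cst 1) = 0].

(* H is L2 P or its closed subspace L2_centered P; completeness is the
   L^2-convergence of the Fourier expansion of every element of H. *)
Definition orthonormal_basis P (H : set (R -> R)) (e : nat -> R -> R) : Prop :=
  [/\ forall j, H (e j),
      forall i j, inner P (e i) (e j) = (i == j)%:R
    & forall h, H h ->
        (fun n => 'N[P]_2%:E[EFin \o (fun x =>
           (h x - \sum_(j < n) inner P (e j) h * e j x)%R)]%E) @ \oo --> 0%E].

Definition U P (b c : R -> R) (zeta : R -> R) : R -> R :=
  if `[< b = c %[ae P] >] then zeta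
  else fun x => zeta x -
    inner P (fun y => b y - c y) zeta / (1 - inner P b c) * (b x - c x).

(* U_chain P b c [:: k_1; ...; k_m] is the composite
   U_{b_{k_m} ct_{k_m}} o ... o U_{b_{k_1} ct_{k_1}}, where ct_{k_1} = c_{k_1}
   and ct_{k_i} is the image of c_{k_i} under the composite of the i-1 first
   operators. *)
Definition U_chain P (I : Type) (b c : I -> R -> R) (s : seq I) :
    (R -> R) -> R -> R :=
  foldl (fun V k => U P (b k) (V (c k)) \o V) idfun s.

Definition ctilde P (p : nat) (b c : 'I_p -> R -> R) (k : 'I_p) : R -> R :=
  U_chain P b c (take k (enum 'I_p)) (c k).

Definition U_all P (p : nat) (b c : 'I_p -> R -> R) : (R -> R) -> R -> R :=
  U_chain P b c (enum 'I_p).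

(* Sanity check: U_chain is the chain of the operators built on ctilde. *)
Lemma U_chain_take P (p : nat) (b c : 'I_p -> R -> R) (k : 'I_p) :
  U_chain P b c (take k.+1 (enum 'I_p)) =
  U P (b k) (ctilde P b c k) \o U_chain P b c (take k (enum 'I_p)).
Proof.
rewrite (take_nth k) ?size_enum_ord// /U_chain foldl_rcons.
by rewrite nth_ord_enum.
Qed.

End L2.

Section parametric_model.
Context {R : realType}.
Implicit Types (P : probability (measurableTypeR R) R) (X : set R).

Definition density_on P X (f : R -> R) : Prop :=
  [/\ measurable X, measurable_fun X f, forall x, X x -> 0 < f x
    & forall A : set R, measurable A ->
        P A = (\int[lebesgue_measure]_(x in A `&` X) (f x)%:E)%E].

(* f t x is the density at x for the parameter t. Components are set to 0
   outside the support, a P-null set. *)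
Definition score X (p : nat) (f : 'rV[R]_p -> R -> R) (theta : 'rV[R]_p)
    (k : 'I_p) : R -> R :=
  (fun x => 'D_(delta_mx 0 k) (fun t => ln (f t x)) theta) \_ X.

Definition gram P (p : nat) (u : 'I_p -> R -> R) : 'M[R]_p :=
  \matrix_(i, j) inner P (u i) (u j).

(* P is the law with parameter theta; the other parameter values intervene
   only through the derivatives at theta. *)
Definition regular_model P X (p : nat) (f : 'rV[R]_p -> R -> R)
    (theta : 'rV[R]_p) : Prop :=
  [/\ density_on P X (f theta),
      forall x, X x -> differentiable (f ^~ x) theta,
      forall k, L2_centered P (score X f theta k)
    & gram P (score X f theta) \in unitmx].

(* The positive semidefinite square root, which is unique. *)
Definition principal_sqrt (p : nat) (A S : 'M[R]_p) : Prop :=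
  [/\ S^T = S, forall v : 'rV[R]_p, 0 <= (v *m S *m v^T) 0 0 & S *m S = A].

Definition mx_lincomb (p : nat) (S : 'M[R]_p) (u : 'I_p -> R -> R) (k : 'I_p) :
    R -> R :=
  fun x => \sum_(j < p) S k j * u j x.

Definition lfun X (f g : R -> R) : R -> R :=
  (fun x => Num.sqrt (f x / g x)) \_ X.

Definition K P (l : R -> R) : (R -> R) -> R -> R := U P l (cst 1).

End parametric_model.

Section empirical_process.
Context {R : realType}.

Definition mutually_independent d (T : measurableType d) (P : probability T R)
    (Xs : nat -> {RV P >-> R}) : Prop :=
  forall (s : seq nat) (A : nat -> set R), uniq s ->
    (forall i, measurable (A i)) ->
    P (\bigcap_(i in [set` s]) (Xs i @^-1` A i)) =
    (\prod_(i <- s) P (Xs i @^-1` A i))%E.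

Definition iid d (T : measurableType d) (P : probability T R)
    (Xs : nat -> {RV P >-> R}) (Q : probability (measurableTypeR R) R) : Prop :=
  mutually_independent Xs /\
  forall i (A : set R), measurable A -> distribution P (Xs i) A = Q A.

Definition empirical (Q : probability (measurableTypeR R) R) (T : Type)
    (Xs : nat -> T -> R) (h : R -> R) (n : nat) (w : T) : R :=
  (Num.sqrt n%:R)^-1 * \sum_(i < n) (h (Xs i w) - fine 'E_Q[h]).

Definition borel_rV (m : nat) := g_sigma_algebraType (@open 'rV[R]_m).

Definition cvg_in_law d (T : measurableType d) (P : probability T R) (m : nat)
    (V : nat -> T -> 'rV[R]_m) (mu : probability (borel_rV m) R) : Prop :=
  forall f : 'rV[R]_m -> R, continuous f -> (exists M, forall v, `|f v| <= M) ->
    (fun n => 'E_P[f \o V n]%E) @ \oo --> 'E_mu[f]%E.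

(* h and phi are the index functions of the processes attached to Q1 and Q2;
   a finite-dimensional marginal is given by indices J 0, ..., J m.-1. *)
Definition same_limiting_fidi (Q1 Q2 : probability (measurableTypeR R) R)
    (h phi : nat -> R -> R) : Prop :=
  forall (d1 d2 : measure_display)
    (T1 : measurableType d1) (T2 : measurableType d2)
    (P1 : probability T1 R) (P2 : probability T2 R)
    (Xs : nat -> {RV P1 >-> R}) (Ys : nat -> {RV P2 >-> R}),
  iid Xs Q1 -> iid Ys Q2 ->
  forall (m : nat) (J : 'I_m -> nat),
  exists mu : probability (borel_rV m) R,
    cvg_in_law P1
      (fun n w => \row_(i < m) empirical Q1 (fun k => Xs k) (h (J i)) n w) mu /\
    cvg_in_law P2
      (fun n w => \row_(i < m) empirical Q2 (fun k => Ys k) (phi (J i)) n w) mu.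

End empirical_process.

(* Main.v *)
(* Multiplication by l is a unitary map from L^2(F) to L^2(G) which sends 1 to l,
   and K is the reflection exchanging l and 1, so that K l is unitary and sends 1
   to 1. Each further operator is a reflection exchanging two centered unit
   vectors, hence is unitary and fixes 1. The composite is therefore a unitary map
   that preserves means: it transports orthonormal bases, and both empirical
   processes have the same covariances.
   By the central limit theorem, both processes then converge to a Gaussian vector
   with this common covariance A. It is built by writing A as a sum of squares of
   linear forms. The characteristic functions converge by second order estimates,
   and they determine the limit in law because a bounded continuous function f is
   within e + C |x|^2 of a trigonometric polynomial, with C arbitrarily small, the
   second moments being bounded. *)

(* Functions are representatives: the operators are explicit formulas, linear pointwise, while swaps
   and surjectivity hold only almost everywhere; isometry is what carries almost everywhere
   equalities through them. Characteristic functions are kept as pairs of real integrals, of a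
   cosine and of a sine, and the n-th power of the transform of one summand becomes the n-th iterate
   of a plane linear map. Independence is given for events only, so product formulas are first
   raised from indicators to integrable functions. In the approximation, C is 2 M / a^2 with a the
   half-width of a box; the trigonometric polynomial depends on a, so a must be chosen before it,
   from a bound on second moments uniform in n. This takes the place of tightness. The transform of
   the normal law is not computed by calculus: stability under addition gives a functional equation,
   and the one-dimensional limit theorem, applied to the normal law itself, solves it. The variance
   enters only through its positivity. *)
From HB Require Import structures.
From mathcomp Require Import ring lra measurable_realfun.
Require Import Defs.
Import Order.TTheory GRing.Theory Num.Theory.
Import numFieldNormedType.Exports.
Import HBNNSimple.
Local Open Scope classical_set_scope.
Local Open Scope ring_scope.

Set Implicit Arguments.
Unset Strict Implicit.
Unset Printing Implicit Defensive.

(** * Isometries and reflections of L^2 *)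

(* Restated because instance resolution does not find the filter of almost
   everywhere sets on [measurableTypeR R]. *)
Lemma aeW {R : realType} d (T : measurableType d) (P : probability T R)
    (A : T -> Prop) : (forall x, A x) -> \forall x \ae P, A x.
Proof. by move=> AT; apply: (@filterE _ _ (ae_filter_ringOfSetsType P)). Qed.

Lemma aeS {R : realType} d (T : measurableType d) (P : probability T R)
    (A B : T -> Prop) :
  (forall x, A x -> B x) -> (\forall x \ae P, A x) -> \forall x \ae P, B x.
Proof. by move=> AB; apply: (@filterS _ _ (ae_filter_ringOfSetsType P)). Qed.

Lemma aeS2 {R : realType} d (T : measurableType d) (P : probability T R)
    (A B C : T -> Prop) : (forall x, A x -> B x -> C x) ->
  (\forall x \ae P, A x) -> (\forall x \ae P, B x) -> \forall x \ae P, C x.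
Proof. by move=> AB; apply: (@filterS2 _ _ (ae_filter_ringOfSetsType P)). Qed.

Section L2_theory.
Context {R : realType}.
Implicit Types (P : probability (measurableTypeR R) R) (h k : R -> R).

Lemma L2P P h : L2 P h <-> measurable_fun [set: R] h /\
  P.-integrable [set: R] (EFin \o (fun x => h x ^+ 2)).
Proof.
split=> [Ph|[mh ih]].
  split; last by apply: Lfun2_integrable_sqr.
  by move: Ph; rewrite /L2/= inE => /andP[]; rewrite inE.
rewrite /L2/= inE; apply/andP; split; rewrite inE//=.
rewrite /finite_norm unlock poweR_lty//.
under eq_integral => x _ do rewrite /= powR_mulrn ?normr_ge0// real_normK ?num_real//.
case/integrableP : ih => _; apply: le_lt_trans.
by rewrite le_eqVlt; apply/orP; left; apply/eqP; apply: eq_integral => x _ /=;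
  rewrite ger0_norm ?sqr_ge0.
Qed.

Lemma L2_measurable P h : L2 P h -> measurable_fun [set: R] h.
Proof. by case/L2P. Qed.

Lemma L2_lin P a h k : L2 P h -> L2 P k -> L2 P (fun x => a * h x + k x).
Proof.
have le12 : (1 <= 2%:E :> \bar R)%E by rewrite lee_fin ler1n.
rewrite /L2/= => hP kP; have [_ cl] := Lfun_submod_closed P le12.
exact: (cl a h k).
Qed.

Lemma L2_cst P c : L2 P (cst c).
Proof. exact: Lfun_cst. Qed.

Lemma L2Z P a h : L2 P h -> L2 P (fun x => a * h x).
Proof.
move=> hP; have := L2_lin a hP (L2_cst P 0).
by congr L2; apply/funext => x /=; rewrite addr0.
Qed.

Lemma L2D P h k : L2 P h -> L2 P k -> L2 P (fun x => h x + k x).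
Proof.
move=> hP kP; have := L2_lin 1 hP kP.
by congr L2; apply/funext => x /=; rewrite mul1r.
Qed.

Lemma L2B P h k : L2 P h -> L2 P k -> L2 P (fun x => h x - k x).
Proof.
move=> hP kP; have := L2_lin (-1) kP hP.
by congr L2; apply/funext => x /=; ring.
Qed.

Lemma L2_sum P (I : Type) (s : seq I) (h : I -> R -> R) :
  (forall i, L2 P (h i)) -> L2 P (fun x => \sum_(i <- s) h i x).
Proof.
move=> hP; elim: s => [|i s ih].
  by under eq_fun do rewrite big_nil; exact: L2_cst.
by under eq_fun do rewrite big_cons; exact: L2D.
Qed.

Lemma L2_mul_integrable P h k : L2 P h -> L2 P k ->
  P.-integrable [set: R] (EFin \o (fun x => h x * k x)).
Proof. by move=> hP kP; apply/Lfun1_integrable; exact: Lfun2_mul_Lfun1. Qed.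

Lemma L2_integrable P h : L2 P h -> P.-integrable [set: R] (EFin \o h).
Proof.
move=> hP; have := L2_mul_integrable hP (L2_cst P 1).
by congr integrable; apply/funext => x /=; rewrite mulr1.
Qed.

Lemma innerC P h k : inner P h k = inner P k h.
Proof. by rewrite /inner; under eq_Rintegral do rewrite mulrC. Qed.

Lemma inner_linl P a h h' k : L2 P h -> L2 P h' -> L2 P k ->
  inner P (fun x => a * h x + h' x) k = a * inner P h k + inner P h' k.
Proof.
move=> hP h'P kP; rewrite /inner.
under eq_Rintegral do rewrite mulrDl -mulrA.
rewrite RintegralD//.
- by rewrite RintegralZl//; exact: L2_mul_integrable.
- have := L2_mul_integrable (L2Z a hP) kP.
  by congr integrable; apply/funext => x /=; rewrite mulrA.
- exact: L2_mul_integrable.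
Qed.

Lemma inner_linr P a h h' k : L2 P h -> L2 P h' -> L2 P k ->
  inner P k (fun x => a * h x + h' x) = a * inner P k h + inner P k h'.
Proof. by move=> *; rewrite innerC inner_linl// (innerC _ k) (innerC _ k). Qed.

Lemma innerZl P a h k : L2 P h -> L2 P k ->
  inner P (fun x => a * h x) k = a * inner P h k.
Proof.
move=> hP kP; rewrite /inner; under eq_Rintegral do rewrite -mulrA.
by rewrite RintegralZl//; exact: L2_mul_integrable.
Qed.

Lemma innerZr P a h k : L2 P h -> L2 P k ->
  inner P k (fun x => a * h x) = a * inner P k h.
Proof. by move=> *; rewrite innerC innerZl// innerC. Qed.

Lemma innerDl P h h' k : L2 P h -> L2 P h' -> L2 P k ->
  inner P (fun x => h x + h' x) k = inner P h k + inner P h' k.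
Proof.
move=> hP h'P kP; rewrite /inner; under eq_Rintegral do rewrite mulrDl.
by rewrite RintegralD//; exact: L2_mul_integrable.
Qed.

Lemma innerDr P h h' k : L2 P h -> L2 P h' -> L2 P k ->
  inner P k (fun x => h x + h' x) = inner P k h + inner P k h'.
Proof. by move=> *; rewrite innerC innerDl// (innerC _ k) (innerC _ k). Qed.

Lemma innerBl P h h' k : L2 P h -> L2 P h' -> L2 P k ->
  inner P (fun x => h x - h' x) k = inner P h k - inner P h' k.
Proof.
move=> hP h'P kP; rewrite /inner; under eq_Rintegral do rewrite mulrBl.
by rewrite RintegralB//; exact: L2_mul_integrable.
Qed.

Lemma innerBr P h h' k : L2 P h -> L2 P h' -> L2 P k ->
  inner P k (fun x => h x - h' x) = inner P k h - inner P k h'.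
Proof. by move=> *; rewrite innerC innerBl// (innerC _ k) (innerC _ k). Qed.

Lemma inner0l P k : inner P (cst 0) k = 0.
Proof. by rewrite /inner; under eq_Rintegral do rewrite mul0r; rewrite Rintegral_cst// mul0r. Qed.

Lemma inner_suml P (I : Type) (s : seq I) (h : I -> R -> R) k :
  (forall i, L2 P (h i)) -> L2 P k ->
  inner P (fun x => \sum_(i <- s) h i x) k = \sum_(i <- s) inner P (h i) k.
Proof.
move=> hP kP; elim: s => [|i s ih].
  by under eq_fun do rewrite big_nil; rewrite big_nil inner0l.
under eq_fun do rewrite big_cons; rewrite big_cons innerDl ?ih//.
exact: L2_sum.
Qed.

Lemma inner11 P : inner P (cst 1) (cst 1) = 1.
Proof.
rewrite /inner; under eq_Rintegral do rewrite mulr1.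
by rewrite Rintegral_cst// mul1r [X in fine X](_ : _ = 1%E)//; exact: probability_setT.
Qed.

Lemma inner_ge0 P h : 0 <= inner P h h.
Proof. by apply: Rintegral_ge0 => x _; rewrite -expr2 sqr_ge0. Qed.

Lemma inner_ae P h h' k : L2 P h -> L2 P h' -> L2 P k ->
  h = h' %[ae P] -> inner P h k = inner P h' k.
Proof.
move=> hP h'P kP hh'; rewrite /inner /Rintegral; congr fine.
apply: ae_eq_integral => //.
- by case/integrableP : (L2_mul_integrable hP kP).
- by case/integrableP : (L2_mul_integrable h'P kP).
- by case: hh' => N [mN N0 sN]; exists N; split=> // x /= nx; apply: sN => /=;
    apply: contra_not nx => /= + xT => -> .
Qed.

Lemma inner_eq0 P h : L2 P h -> inner P h h = 0 -> h = cst 0 %[ae P].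
Proof.
move=> hP h0; have ih := L2_mul_integrable hP hP.
have I0 : (\int[P]_x `|(h x * h x)%:E| = 0)%E.
  transitivity (inner P h h)%:E; last by rewrite h0.
  rewrite /inner /Rintegral fineK; last exact: integrable_fin_num.
  apply: eq_integral => x _ /=.
  by rewrite ger0_norm// -expr2 sqr_ge0.
have := (ae_eq_integral_abs P measurableT _).1 I0.
case/integrableP : ih => mh _ /(_ mh).
by apply: aeS => x /= /(_ I) [/eqP]; rewrite mulf_eq0 orbb => /eqP.
Qed.

Lemma Lnorm2E P h : L2 P h ->
  ('N[P]_2%:E[EFin \o h] = (inner P h h `^ 2^-1)%:E)%E.
Proof.
move=> hP; rewrite unlock -poweR_EFin; congr (_ `^ _)%E.
rewrite /inner /Rintegral fineK; last first.
  by apply: integrable_fin_num => //; exact: L2_mul_integrable.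
apply: eq_integral => x _ /=.
by rewrite powR_mulrn ?normr_ge0// real_normK ?num_real// expr2.
Qed.

Lemma inner_eq0_sub P h k : L2 P h -> L2 P k ->
  inner P (fun x => h x - k x) (fun x => h x - k x) = 0 -> h = k %[ae P].
Proof.
move=> hP kP /(inner_eq0 (L2B hP kP)).
by apply: aeS => x /= /(_ I) /eqP; rewrite subr_eq0 => /eqP.
Qed.

Lemma ae_inner_sub P h k : L2 P h -> L2 P k -> h = k %[ae P] ->
  inner P (fun x => h x - k x) (fun x => h x - k x) = 0.
Proof.
move=> hP kP hk; rewrite -(inner0l P (fun x => h x - k x)).
apply: inner_ae => //; try exact: L2B; first exact: L2_cst.
by apply: aeS hk => x /= /(_ I) ->; rewrite subrr.
Qed.

(** Linearity is an equality of functions, not of classes: the operators in play are given by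
    formulas, and a pointwise identity can be rewritten under [T]. Surjectivity in [L2_unitary] is
    asked almost everywhere, as a product with [lfun] vanishes outside the support. *)
Definition L2_isometry P Q (T : (R -> R) -> R -> R) :=
  [/\ forall h, L2 P h -> L2 Q (T h),
      forall a h k, L2 P h -> L2 P k ->
        T (fun x => a * h x + k x) = (fun x => a * T h x + T k x)
    & forall h k, L2 P h -> L2 P k -> inner Q (T h) (T k) = inner P h k].

Definition L2_unitary P Q (T : (R -> R) -> R -> R) := L2_isometry P Q T /\
  forall k, L2 Q k -> exists2 h, L2 P h & T h = k %[ae Q].

Lemma L2_isometryB P Q T h k : L2_isometry P Q T -> L2 P h -> L2 P k ->
  T (fun x => h x - k x) = (fun x => T h x - T k x).
Proof.
case=> _ lin _ hP kP; have := lin (-1) k h kP hP.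
rewrite (_ : (fun x => -1 * k x + h x) = (fun x => h x - k x)); last first.
  by apply/funext => x; ring.
by move=> ->; apply/funext => x; ring.
Qed.

(** T h - T k is the image of h - k, whose norm is 0. Thus [T], though it acts on representatives,
    is well defined on classes. *)
Lemma L2_isometry_ae P Q T h k : L2_isometry P Q T -> L2 P h -> L2 P k ->
  h = k %[ae P] -> T h = T k %[ae Q].
Proof.
move=> isoT hP kP hk; have [TQ _ iT] := isoT.
apply: inner_eq0_sub; try exact: TQ.
by rewrite -(L2_isometryB isoT)// iT ?ae_inner_sub//; exact: L2B.
Qed.

Lemma L2_isometry_comp P Q S T T' :
  L2_isometry P Q T -> L2_isometry Q S T' -> L2_isometry P S (T' \o T).
Proof.
move=> [TQ linT iT] [T'Q linT' iT']; split => [h hP|a h k hP kP|h k hP kP] /=.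
- by apply/T'Q/TQ.
- by rewrite linT// linT'//; exact: TQ.
- by rewrite iT' ?iT//; exact: TQ.
Qed.

Lemma L2_unitary_comp P Q S T T' :
  L2_unitary P Q T -> L2_unitary Q S T' -> L2_unitary P S (T' \o T).
Proof.
move=> [isoT ontoT] [isoT' ontoT']; split; first exact: L2_isometry_comp isoT'.
move=> k /ontoT'[h' h'Q h'k]; have [h hP hh'] := ontoT _ h'Q.
exists h => //=; have [TQ _ _] := isoT.
have := L2_isometry_ae isoT' (TQ _ hP) h'Q hh'.
by move: h'k; apply: aeS2 => x /= /(_ I) <- /(_ I) ->.
Qed.

Lemma L2_unitary_id P : L2_unitary P P idfun.
Proof.
split; first by split.
by move=> k kP; exists k => //; exact: aeW.
Qed.

(** [HP] and [HQ] stand for the whole spaces or for the centered subspaces. If [T h = k] almost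
    everywhere, the Fourier remainders of [k] are the images of those of [h], so the two sequences
    of norms coincide term by term. *)
Lemma onb_unitary P Q T (HP HQ : set (R -> R)) (e : nat -> R -> R) :
  L2_unitary P Q T -> HP `<=` L2 P -> HQ `<=` L2 Q ->
  (forall h, L2 P h -> HP h <-> HQ (T h)) ->
  (forall h k, L2 Q k -> h = k %[ae Q] -> HQ h -> HQ k) ->
  orthonormal_basis P HP e -> orthonormal_basis Q HQ (fun j => T (e j)).
Proof.
move=> [isoT ontoT] HPL HQL HT HQae [eH eo ec]; have [TQ linT iT] := isoT.
have eL j : L2 P (e j) by exact/HPL/eH.
split=> [j|i j|k kQ]; first exact/HT/eH.
  by rewrite iT.
have [h hP hk] := ontoT _ (HQL _ kQ).
have kL := HQL _ kQ.
have hH : HP h.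
  apply/HT => //; apply: HQae kQ; first exact: TQ.
  by apply: aeS hk => x /= /(_ I) ->.
have := ec h hH; set u := (X in X @ _ --> _); set v := (X in _ -> X @ _ --> _).
suff -> : u = v by [].
apply/funext => n; rewrite /u /v.
set r := fun x => h x - \sum_(j < n) inner P (e j) h * e j x.
set s := fun x => k x - \sum_(j < n) inner Q (T (e j)) k * T (e j) x.
have rP : L2 P r by apply: L2B => //; apply: L2_sum => j; exact: L2Z.
have sQ : L2 Q s.
  by apply: L2B => //; apply: L2_sum => j; apply: L2Z; exact: TQ.
rewrite (Lnorm2E rP) (Lnorm2E sQ); congr ((_ `^ _)%:E).
have Tr : T r = s %[ae Q].
  have -> : T r = fun x => T h x - \sum_(j < n) inner P (e j) h * T (e j) x.
    (* [linT] handles one scalar multiple at a time, so the partial sum is pulled out by induction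
       on its length. *)
    rewrite /r; elim: (n) => [|m ih].
      have E g : (fun x => g x - \sum_(j < 0) inner P (e j) h * e j x) = g.
        by apply/funext => x; rewrite big_ord0 subr0.
      by rewrite E; apply/funext => x; rewrite big_ord0 subr0.
    have -> : (fun x => h x - \sum_(j < m.+1) inner P (e j) h * e j x) =
        (fun x => - inner P (e m) h * e m x +
          (h x - \sum_(j < m) inner P (e j) h * e j x)).
      by apply/funext => x; rewrite big_ord_recr/=; ring.
    rewrite linT// ?ih.
      by apply/funext => x; rewrite big_ord_recr/=; ring.
    by apply: L2B => //; apply: L2_sum => j; exact: L2Z.
  have E j : inner P (e j) h = inner Q (T (e j)) k.
    rewrite -iT// innerC (innerC _ _ k); apply: inner_ae => //; exact: TQ.
  rewrite /s; apply: aeS hk => x /= /(_ I) <- _; congr (_ - _).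
  by apply: eq_bigr => j _; rewrite E.
have TrQ := TQ _ rP.
rewrite -iT// (inner_ae TrQ sQ TrQ Tr) innerC.
by rewrite (inner_ae TrQ sQ sQ Tr).
Qed.

Lemma onb_unitary_L2 P Q T e : L2_unitary P Q T ->
  orthonormal_basis P (L2 P) e ->
  orthonormal_basis Q (L2 Q) (fun j => T (e j)).
Proof.
move=> uT; apply: (onb_unitary uT) => // h hP; have [[TQ _ _] _] := uT.
by split=> // _; exact: TQ.
Qed.

Lemma onb_unitary_centered P Q T e : L2_unitary P Q T ->
  (forall h, L2 P h -> inner Q (T h) (cst 1) = inner P h (cst 1)) ->
  orthonormal_basis P (L2_centered P) e ->
  orthonormal_basis Q (L2_centered Q) (fun j => T (e j)).
Proof.
move=> uT T1; apply: (onb_unitary uT) => //; [by move=> ? []|by move=> ? []| |].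
  have [[TQ _ _] _] := uT => h hP.
  by split=> -[_ h1]; split=> //; [exact: TQ|rewrite T1|rewrite -T1].
move=> h k kQ hk [hQ h1]; split=> //.
by rewrite -(inner_ae hQ kQ (L2_cst Q 1) hk).
Qed.

End L2_theory.

Section reflections.
Context {R : realType} (P : probability (measurableTypeR R) R).
Implicit Types (b c h : R -> R).

(** For unit vectors |b - c|^2 = 2 (1 - <b, c>), so the denominator vanishes only when b = c almost
    everywhere, which is the other branch of [U]. *)
Lemma UE b c : L2 P b -> L2 P c -> inner P b b = 1 -> inner P c c = 1 ->
  (b = c %[ae P] /\ U P b c = id) \/ (1 - inner P b c != 0 /\ U P b c = fun h x => h x -
    inner P (fun y => b y - c y) h / (1 - inner P b c) * (b x - c x)).
Proof.
move=> bP cP b1 c1; have [bc|bc] := pselect (b = c %[ae P]).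
  by left; split=> //; apply/funext => h; rewrite /U asboolT.
right; split.
  apply/negP => /eqP bc0; apply: bc; apply: inner_eq0_sub => //.
  rewrite innerBl// ?innerBr//; try exact: L2B.
  by rewrite b1 c1 (innerC _ c b); lra.
by apply/funext => h; rewrite /U asboolF.
Qed.

(** With d = b - c one has <d, d> = 2 (1 - <b, c>), so the formula reads h - 2 <d, h> / <d, d> d:
    the reflection in the hyperplane orthogonal to d. *)
Lemma U_isometry b c : L2 P b -> L2 P c -> inner P b b = 1 ->
  inner P c c = 1 -> L2_isometry P P (U P b c).
Proof.
move=> bP cP b1 c1; have [[_ ->]|[bc0 ->]] := UE bP cP b1 c1; first by split.
have dP := L2B bP cP.
set d := fun y => b y - c y in dP *.
have dd : inner P d d = 2 * (1 - inner P b c).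
  rewrite innerBl// !innerBr// b1 c1 (innerC _ c b); ring.
have L h k : L2 P h -> L2 P (fun x => h x - k * d x).
  by move=> hP; apply: L2B => //; exact: L2Z.
split=> [h hP|r h k hP kP|h k hP kP] /=.
- exact: L.
- by apply/funext => x; rewrite inner_linr//; ring.
- have Zd r : L2 P (fun x => r * d x) by exact: L2Z.
  rewrite innerBl ?innerBr//; try exact: L.
  rewrite !(innerZl, innerZr)// dd (innerC _ h d).
  by field.
Qed.

(** A reflection is its own inverse; this provides the preimages in [U_unitary]. *)
Lemma UK b c h : L2 P b -> L2 P c -> inner P b b = 1 ->
  inner P c c = 1 -> L2 P h -> U P b c (U P b c h) = h.
Proof.
move=> bP cP b1 c1 hP; have [[_ ->]//|[bc0 ->]] := UE bP cP b1 c1.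
have dP := L2B bP cP.
set d := fun y => b y - c y in dP *.
have dd : inner P d d = 2 * (1 - inner P b c).
  rewrite innerBl// !innerBr// b1 c1 (innerC _ c b); ring.
apply/funext => x; rewrite -/(d x) innerBr//; last exact: L2Z.
by rewrite innerZr// dd; field.
Qed.

Lemma U_swap b c : L2 P b -> L2 P c -> inner P b b = 1 ->
  inner P c c = 1 -> U P b c b = c %[ae P].
Proof.
move=> bP cP b1 c1; have [[bc ->]//|[bc0 ->]] := UE bP cP b1 c1.
apply: aeW => x _; rewrite innerBl// b1 (innerC _ c) divff// mul1r; ring.
Qed.

Lemma U_unitary b c : L2 P b -> L2 P c -> inner P b b = 1 ->
  inner P c c = 1 -> L2_unitary P P (U P b c).
Proof.
move=> bP cP b1 c1; have isoU := U_isometry bP cP b1 c1; split=> // h hP.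
have [UP _ _] := isoU.
by exists (U P b c h); [exact: UP|rewrite UK//; exact: aeW].
Qed.

(** The constant 1 is orthogonal to b - c, hence lies in the mirror of the reflection. *)
Lemma U_fix1 b c : L2 P b -> L2 P c -> inner P b (cst 1) = 0 ->
  inner P c (cst 1) = 0 -> U P b c (cst 1) = cst 1.
Proof.
move=> bP cP b1 c1; rewrite /U; case: ifPn => // _; apply/funext => x.
rewrite innerBl//; last exact: L2_cst.
by rewrite b1 c1 subrr !mul0r subr0.
Qed.

Lemma U_chain_unitary (I : Type) (b c : I -> R -> R) (s : seq I) :
  (forall k, L2_centered P (b k)) -> (forall k, inner P (b k) (b k) = 1) ->
  (forall k, L2_centered P (c k)) -> (forall k, inner P (c k) (c k) = 1) ->
  L2_unitary P P (U_chain P b c s) /\ U_chain P b c s (cst 1) = cst 1.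
Proof.
move=> bC b1 cC c1; rewrite /U_chain.
have := L2_unitary_id P; have : idfun (cst 1 : R -> R) = cst 1 by [].
(* [foldl] composes onto its accumulator, so before the induction the initial [idfun] is generalized
   to any unitary operator fixing 1. *)
move: (idfun : (R -> R) -> R -> R); elim: s => [V V1 uV//|k s ih V V1 uV] /=.
have [[VP _ iV] _] := uV.
have [cL c0] := cC k; have [bL b0] := bC k.
have VL := VP _ cL.
(* [V] fixes 1 and preserves inner products, so [V (c k)] is still centered, and the next reflection
   again exchanges two centered unit vectors. *)
have V0 : inner P (V (c k)) (cst 1) = 0.
  by rewrite -V1 iV//; exact: L2_cst.
apply: ih; first by rewrite /= V1 U_fix1.
by apply: L2_unitary_comp uV _; apply: U_unitary => //; rewrite iV.
Qed.

End reflections.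

(** The hypothesis on indicators says that [nu] is the image under [xi] of the measure with density
    [M] with respect to [mu]; simple functions and monotone convergence do the rest. With [xi] the
    identity this integrates against a density; with [xi] one observation and [M] a product over the
    others it expresses independence. *)
Lemma ge0_integral_comp_indic (R : realType) d d' (T : measurableType d) (S : measurableType d')
    (mu : {measure set T -> \bar R}) (nu : {measure set S -> \bar R})
    (xi : T -> S) (M : T -> R) (u : S -> \bar R) :
  measurable_fun [set: T] xi -> measurable_fun [set: T] M ->
  (forall x, 0 <= M x) ->
  (forall A, measurable A -> (\int[mu]_x (\1_A (xi x) * M x)%R%:E = nu A)%E) ->
  measurable_fun [set: S] u -> (forall y, 0 <= u y)%E ->
  (\int[mu]_x (u (xi x) * (M x)%:E) = \int[nu]_y u y)%E.
Proof.
move=> mxi mM M0 ind mu_ u0; pose g := nnsfun_approx measurableT mu_.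
have mg n : measurable_fun [set: T] (fun x => (g n (xi x) * M x)%:E).
  apply/measurable_EFinP/measurable_funM => //.
  by apply: measurableT_comp => //; exact: measurable_funPT.
transitivity (limn (fun n => \int[mu]_x (g n (xi x) * M x)%:E)%E).
  rewrite -monotone_convergence//.
  - apply: eq_integral => x _; apply/esym/cvg_lim => //.
    under eq_fun do rewrite EFinM.
    by apply: cvgeZr => //; exact: cvg_nnsfun_approx.
  - by move=> n x _; rewrite lee_fin mulr_ge0.
  - move=> x _ a b ab; rewrite lee_fin ler_wpM2r//.
    exact/lefP/nd_nnsfun_approx.
transitivity (limn (fun n => \int[nu]_y (g n y)%:E)%E); last first.
  rewrite -monotone_convergence//.
  - by apply: eq_integral => x _; apply/cvg_lim => //; exact: cvg_nnsfun_approx.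
  - by move=> n; exact/measurable_EFinP/measurable_funP.
  - by move=> n x _; rewrite lee_fin.
  - by move=> x _ a b ab; rewrite lee_fin; exact/lefP/nd_nnsfun_approx.
congr (limn _); apply/funext => n.
transitivity (\sum_(r \in range (g n))
    \int[nu]_x (r%:E * (\1_(g n @^-1` [set r]) x)%:E))%E; last first.
  rewrite -ge0_integral_fsum//.
  - apply: eq_integral => x _; by rewrite [in RHS]fimfunE -fsumEFin.
  - by move=> r; apply: measurable_funeM; apply/measurable_EFinP.
  - by move=> r x _; exact: nnfun_muleindic_ge0.
transitivity (\sum_(r \in range (g n))
    \int[mu]_x (r%:E * (\1_(g n @^-1` [set r]) (xi x) * M x)%:E))%E.
  rewrite -ge0_integral_fsum//.
  - apply: eq_integral => x _; rewrite fimfunE.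
    rewrite mulr_fsuml -fsumEFin//.
    by apply: eq_fsbigr => r _; rewrite -EFinM mulrA.
  - move=> r; apply: measurable_funeM; apply/measurable_EFinP.
    apply: measurable_funM => //.
    by apply: measurableT_comp => //.
  - move=> r x _; rewrite EFinM muleA mule_ge0 ?lee_fin//.
    exact: nnfun_muleindic_ge0.
apply: eq_fsbigr => r /set_mem[y _ yr].
have r0 : 0 <= r by rewrite -yr.
rewrite !ge0_integralZl//.
- by rewrite ind// integral_indic// setIT.
- by apply/measurable_EFinP; exact: measurable_indic.
- apply/measurable_EFinP/measurable_funM => //.
  by apply: measurableT_comp => //; exact: measurable_indic.
- by move=> x _; rewrite lee_fin mulr_ge0.
Qed.

(** Polarization: <h, k> is read off the norms of h + k, h and k. Only integrals of squares remain
    to be compared, and a change of density applies directly to these nonnegative integrands. *)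
Lemma L2_isometry_norm {R : realType}
    (P Q : probability (measurableTypeR R) R) (T : (R -> R) -> R -> R) :
  (forall h, L2 P h -> L2 Q (T h)) ->
  (forall a h k, L2 P h -> L2 P k ->
    T (fun x => a * h x + k x) = (fun x => a * T h x + T k x)) ->
  (forall h, L2 P h -> inner Q (T h) (T h) = inner P h h) ->
  L2_isometry P Q T.
Proof.
move=> TQ linT nT; split=> // h k hP kP.
have hkP := L2D hP kP.
have ThkE : T (fun x => h x + k x) = fun x => T h x + T k x.
  have := linT 1 h k hP kP.
  rewrite (_ : (fun x => 1 * h x + k x) = (fun x => h x + k x)); last first.
    by apply/funext => x; rewrite mul1r.
  by move=> ->; apply/funext => x; rewrite mul1r.
have := nT _ hkP; rewrite ThkE.
have ThQ := TQ _ hP; have TkQ := TQ _ kP.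
rewrite innerDl ?innerDr//; try exact: L2D.
rewrite innerDl//.
rewrite (innerDl hP kP kP) (innerC _ k h) (innerC _ (T k) (T h)) !nT//; lra.
Qed.

(** * Densities and the transfer operator *)

Section densities.
Context {R : realType}.
Implicit Types (P Q : probability (measurableTypeR R) R) (X : set R).
Notation lambda := (@lebesgue_measure R).

Lemma density_integral P X f (u : measurableTypeR R -> \bar R) :
  density_on P X f -> measurable_fun [set: measurableTypeR R] u -> (forall y, 0 <= u y)%E ->
  (\int[P]_y u y = \int[lambda]_x (u x * ((f \_ X) x)%:E))%E.
Proof.
move=> [mX mf f0 PE] mu u0; apply/esym.
apply: (@ge0_integral_comp_indic _ _ _ _ _ lambda P idfun (f \_ X) u) => //.
- exact: measurable_id.
- exact/(measurable_restrictT _ mX).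
- by move=> x; rewrite patchE; case: ifPn => // /set_mem /f0/ltW.
move=> A mA; apply: esym; apply: (eq_trans (PE A mA)).
rewrite [LHS]integral_mkcond; apply: eq_integral => x _.
rewrite !patchE /= indicE in_setI; case: (x \in A) => /=; rewrite ?mul0r//.
by rewrite mul1r; case: ifPn.
Qed.

Lemma density_support P X f : density_on P X f -> P (~` X) = 0%E.
Proof.
by case=> mX _ _ PE; rewrite PE ?setICl ?integral_set0//; exact: measurableC.
Qed.

Lemma measurable_lfun P Q X f g : density_on P X f -> density_on Q X g ->
  measurable_fun [set: R] (lfun X f g).
Proof.
move=> [mX mf f0 _] [_ mg g0 _]; apply/(measurable_restrictT _ mX).
have : measurable_fun X (fun x => f x `^ 2^-1 * g x `^ (- 2^-1)).
  by apply: measurable_funM; apply: (measurableT_comp (measurable_powR _)).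
apply: eq_measurable_fun => x /set_mem Xx.
rewrite powRN -powR12_sqrt ?divr_ge0 ?ltW ?f0 ?g0//.
rewrite powRM ?invr_ge0 ?ltW ?f0 ?g0//; congr (_ * _).
by rewrite -powRN -[in RHS]powR_inv1 ?ltW ?g0// -powRrM mulN1r.
Qed.

Lemma lfun_sqr P Q X f g x : density_on P X f -> density_on Q X g ->
  lfun X f g x ^+ 2 * (g \_ X) x = (f \_ X) x.
Proof.
move=> [_ _ f0 _] [_ _ g0 _]; rewrite /lfun !patchE.
case: ifPn => [/set_mem Xx|_]; last by rewrite mulr0.
rewrite sqr_sqrtr ?divr_ge0 ?ltW ?f0 ?g0// divfK//.
by rewrite gt_eqF// g0.
Qed.

Lemma lfun_isometry P Q X f g : density_on P X f -> density_on Q X g ->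
  L2_isometry P Q (fun h x => lfun X f g x * h x).
Proof.
move=> dP dQ; set l := lfun X f g.
have ml : measurable_fun [set: measurableTypeR R] l := measurable_lfun dP dQ.
have N h : measurable_fun [set: measurableTypeR R] h ->
    (\int[Q]_x ((l x * h x) ^+ 2)%:E = \int[P]_x (h x ^+ 2)%:E)%E.
  move=> mh; rewrite (density_integral dQ); first last.
  - by move=> y; rewrite lee_fin sqr_ge0.
  - by apply/measurable_EFinP/measurable_funX/measurable_funM.
  rewrite (density_integral dP); first last.
  - by move=> y; rewrite lee_fin sqr_ge0.
  - by apply/measurable_EFinP/measurable_funX.
  apply: eq_integral => x _; rewrite -!EFinM; congr EFin.
  by rewrite -(lfun_sqr x dP dQ) -/l exprMn mulrAC mulrC.
apply: L2_isometry_norm => [h hP|a h k hP kP|h hP].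
- apply/L2P; split; first by apply: measurable_funM => //; exact: L2_measurable hP.
  have mh := L2_measurable hP.
  have /L2P[_ /integrableP[_ fh]] := hP.
  apply/integrableP; split.
    by apply/measurable_EFinP/measurable_funX/measurable_funM.
  move: fh; apply: le_lt_trans.
  under eq_integral do rewrite /= ger0_norm ?sqr_ge0//.
  under [leRHS]eq_integral do rewrite /= ger0_norm ?sqr_ge0//.
  by rewrite N.
- by apply/funext => x; ring.
- rewrite /inner /Rintegral; congr fine.
  by rewrite -[RHS]N//; exact: L2_measurable hP.
Qed.

(** The inverse is multiplication by sqrt (g / f): the two factors have product 1 on the support,
    whose complement is [Q]-null. *)
Lemma lfun_unitary P Q X f g : density_on P X f -> density_on Q X g ->
  L2_unitary P Q (fun h x => lfun X f g x * h x).
Proof.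
move=> dP dQ; split; first exact: lfun_isometry.
move=> k kQ; exists (fun x => lfun X g f x * k x).
  by have [/(_ _ kQ)] := lfun_isometry dQ dP.
have [mX _ f0 _] := dP; have [_ _ g0 _] := dQ.
exists (~` X); split; [exact: measurableC|exact: density_support dQ|].
move=> x /=; apply: contra_notP => /= /contrapT Xx _.
rewrite /lfun !patchE mem_set// mulrA -sqrtrM ?divr_ge0 ?ltW ?f0 ?g0//.
rewrite mulrA divfK ?gt_eqF ?g0// divff ?gt_eqF ?f0//.
by rewrite sqrtr1 mul1r.
Qed.

(** [lfun] is the image of the constant 1 under an isometry. *)
Lemma lfun_norm P Q X f g : density_on P X f -> density_on Q X g ->
  L2 Q (lfun X f g) /\ inner Q (lfun X f g) (lfun X f g) = 1.
Proof.
move=> dP dQ; have [lQ _ il] := lfun_isometry dP dQ.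
have E : lfun X f g = (fun x => lfun X f g x * cst 1 x).
  by apply/funext => x; rewrite mulr1.
rewrite E il ?inner11//; try exact: L2_cst.
by split=> //; apply: lQ; exact: L2_cst.
Qed.

End densities.

Section whitened_scores.
Context {R : realType} (P : probability (measurableTypeR R) R) (p : nat).
Variables (u : 'I_p -> R -> R) (S : 'M[R]_p).
Hypotheses (uP : forall k, L2_centered P (u k)) (gu : gram P u \in unitmx).
Hypothesis (Su : principal_sqrt (invmx (gram P u)) S).

Lemma mx_lincomb_centered k : L2_centered P (mx_lincomb S u k).
Proof.
have uL j : L2 P (u j) by have [] := uP j.
split; first by apply: L2_sum => j; exact: L2Z.
rewrite /mx_lincomb inner_suml; [|by move=> j; exact: L2Z|exact: L2_cst].
rewrite big1// => j _; have [_ u0] := uP j.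
by rewrite innerZl ?u0 ?mulr0//; exact: L2_cst.
Qed.

(** The Gram matrix of the new family is S Gamma S^T = S Gamma S, with Gamma that of [u]. From S S
    Gamma = 1, the square matrix S Gamma is a right, hence also a left, inverse of S, so this
    product is 1. *)
Lemma mx_lincomb_orthonormal i k :
  inner P (mx_lincomb S u i) (mx_lincomb S u k) = (i == k)%:R.
Proof.
have uL j : L2 P (u j) by have [] := uP j.
have uZ s j : L2 P (fun x => s * u j x) by exact: L2Z.
have [ST _ SS] := Su.
transitivity ((S *m gram P u *m S^T) i k).
  rewrite /mx_lincomb inner_suml//; last exact: L2_sum.
  rewrite mxE; under [RHS]eq_bigr do rewrite !mxE big_distrl/=.
  rewrite exchange_big /=; apply: eq_bigr => j _.
  rewrite innerC inner_suml//; apply: eq_bigr => m _.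
  rewrite innerZl// innerZr// (innerC _ (u m)) mxE; ring.
rewrite ST -mulmxA; have : S *m S *m gram P u = 1%:M by rewrite SS mulVmx.
by rewrite -mulmxA => /mulmx1C; rewrite mulmxA => ->; rewrite mxE.
Qed.

End whitened_scores.

Section transfer_operator.
Context {R : realType} (G F : probability (measurableTypeR R) R) (X : set R).
Variables (g f : R -> R) (p : nat) (b a : 'I_p -> R -> R).
Hypotheses (dG : density_on G X g) (dF : density_on F X f).
Hypotheses (bG : forall k, L2_centered G (b k)).
Hypotheses (b1 : forall k, inner G (b k) (b k) = 1).
Hypotheses (aF : forall k, L2_centered F (a k)).
Hypotheses (a1 : forall k, inner F (a k) (a k) = 1).
Let l := lfun X f g.
Let Kl (h : R -> R) := K G l (fun x => l x * h x).

Lemma Kl_unitary : L2_unitary F G Kl.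
Proof.
have [lG l1] := lfun_norm dF dG.
apply: (L2_unitary_comp (lfun_unitary dF dG)).
by apply: U_unitary => //; [exact: L2_cst|exact: inner11].
Qed.

(** [Kl] sends 1 to [K G l l], which is 1 almost everywhere by [U_swap]. The mean of [Kl h] is
    therefore <Kl h, Kl 1>, and isometry concludes. *)
Lemma Kl_mean h : L2 F h -> inner G (Kl h) (cst 1) = inner F h (cst 1).
Proof.
move=> hF; have [[KlG _ iKl] _] := Kl_unitary.
have F1 := L2_cst F 1; have G1 := L2_cst G 1.
rewrite -(iKl _ _ hF F1) innerC (innerC _ (Kl h)).
have [lG l1] := lfun_norm dF dG.
apply: inner_ae => //; [exact: KlG|exact: KlG|].
have lE : (fun x => l x * cst 1 x) = l by apply/funext => x; rewrite mulr1.
by rewrite /Kl lE; apply: aeS (U_swap lG G1 l1 (inner11 G)) => x /= /(_ I) e _; exact: esym e.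
Qed.

Lemma transfer_unitary : L2_unitary F G
  (fun h => U_all G b (fun k => Kl (a k)) (Kl h)).
Proof.
have [[KlG _ iKl] _] := Kl_unitary.
apply: (L2_unitary_comp Kl_unitary).
apply: (U_chain_unitary _ bG b1 _ _).1 => k; have [aL a0] := aF k.
- by split; [exact: KlG|rewrite Kl_mean].
- by rewrite iKl.
Qed.

Lemma transfer_mean h : L2 F h ->
  inner G (U_all G b (fun k => Kl (a k)) (Kl h)) (cst 1) = inner F h (cst 1).
Proof.
move=> hF; have [[KlG _ iKl] _] := Kl_unitary.
have [||[[_ _ iU] _] fix1] :=
    U_chain_unitary (c := fun k => Kl (a k)) (enum 'I_p) bG b1.
- by move=> k; have [aL a0] := aF k; split; [exact: KlG|rewrite Kl_mean].
- by move=> k; have [aL a0] := aF k; rewrite iKl.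
rewrite -(Kl_mean hF) -[in LHS]fix1; apply: iU; first exact: KlG.
exact: L2_cst.
Qed.

End transfer_operator.

(** * Independent samples *)

Section real_integrals.
Context {R : realType} d (T : measurableType d) (P : probability T R).
Implicit Types f g : T -> R.
Local Notation int f := (P.-integrable [set: T] (EFin \o f)).

Lemma EFin_Rintegral f : int f ->
  (\int[P]_x (f x)%:E = (\int[P]_x f x)%:E)%E.
Proof.
by move=> fi; rewrite /Rintegral fineK//; exact: integrable_fin_num fi.
Qed.

Lemma integrable_measurable f : int f -> measurable_fun [set: T] f.
Proof. by case/integrableP => /measurable_EFinP. Qed.

Lemma integrable_addR f g : int f -> int g -> int (fun x => f x + g x).
Proof. by move=> fi gi; exact: (@integrableD _ _ _ P setT measurableT _ _ fi gi). Qed.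

Lemma integrable_subR f g : int f -> int g -> int (fun x => f x - g x).
Proof. by move=> fi gi; exact: (@integrableB _ _ _ P setT measurableT _ _ fi gi). Qed.

Lemma integrable_scaleR a f : int f -> int (fun x => a * f x).
Proof. by move=> fi; have := @integrableZl _ _ _ P setT measurableT a _ fi; apply. Qed.

Lemma integrable_sumR (I : Type) (s : seq I) (f : I -> T -> R) :
  (forall i, int (f i)) -> int (fun x => \sum_(i <- s) f i x).
Proof.
move=> fi; elim: s => [|i s ih].
  under eq_fun do rewrite big_nil.
  by have := finite_measure_integrable_cst P (0 : R); apply.
by under eq_fun do rewrite big_cons; exact: integrable_addR.
Qed.

Lemma integrable_boundedR f M : measurable_fun [set: T] f ->
  (forall x, `|f x| <= M) -> int f.
Proof.
move=> mf fM; apply: (@le_integrable _ _ _ P setT measurableT _ (cst M%:E)) => //.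
- exact/measurable_EFinP.
- by move=> x _ /=; rewrite lee_fin (le_trans (fM x))// ler_norm.
- exact: finite_measure_integrable_cst.
Qed.

Lemma integrable_dominatedR f g : measurable_fun [set: T] f -> int g ->
  (forall x, `|f x| <= g x) -> int f.
Proof.
move=> mf gi fg; apply: (@le_integrable _ _ _ P setT measurableT _ (EFin \o g)) => //.
- exact/measurable_EFinP.
- by move=> x _ /=; rewrite lee_fin (le_trans (fg x))// ler_norm.
Qed.

Lemma Rintegral_sumR (I : Type) (s : seq I) (f : I -> T -> R) :
  (forall i, int (f i)) ->
  \int[P]_x (\sum_(i <- s) f i x) = \sum_(i <- s) \int[P]_x f i x.
Proof.
move=> fi; elim: s => [|i s ih].
  by under eq_Rintegral do rewrite big_nil; rewrite big_nil Rintegral_cst// mul0r.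
under eq_Rintegral do rewrite big_cons.
rewrite big_cons -ih; apply: RintegralD => //.
exact: integrable_sumR.
Qed.

Lemma Rintegral_cstR a : \int[P]_x a = a.
Proof. by rewrite Rintegral_cst// [X in fine X](_ : _ = 1%E) ?mulr1//; exact: probability_setT. Qed.

Lemma normr_Rintegral_le f g : measurable_fun [set: T] f -> int g ->
  (forall x, `|f x| <= g x) -> `|\int[P]_x f x| <= \int[P]_x g x.
Proof.
move=> mf gi fg; have fi := integrable_dominatedR mf gi fg.
apply: le_trans (le_normr_Rintegral measurableT fi) _.
by apply: le_Rintegral => //; exact: integrable_abse fi.
Qed.

End real_integrals.

Section iid_products.
Context {R : realType} d (T : measurableType d) (P : probability T R).
Variables (Xs : nat -> {RV P >-> R}) (Q : probability (measurableTypeR R) R).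
Hypothesis iidX : iid Xs Q.
Implicit Types (s : seq nat) (u v : nat -> R -> R).

Let integrableQ (f : R -> R) := Q.-integrable [set: R] (EFin \o f).

Let integrable_normQ f : integrableQ f -> integrableQ (fun x => `|f x|).
Proof. by move=> /integrable_abse. Qed.

Let measurable_integrand u s : (forall i, measurable_fun [set: R] (u i)) ->
  measurable_fun [set: T] (fun w => \prod_(i <- s) u i (Xs i w)).
Proof.
by move=> mu; apply: measurable_prod => i _; apply: measurableT_comp.
Qed.

Let prod_indicE s (A : nat -> set R) w :
  \prod_(i <- s) \1_(A i) (Xs i w) =
  \1_(\bigcap_(i in [set` s]) (Xs i @^-1` A i)) w :> R.
Proof.
rewrite indicE; elim: s => [|i s ih].
  by rewrite big_nil mem_set// => j /=.
rewrite big_cons ih indicE -natrM mulnb; congr (_%:R); congr nat_of_bool.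
apply/idP/idP => [/andP[/set_mem Ai /set_mem As]|/set_mem Ais].
  by apply/mem_set => j /=; rewrite inE => /predU1P[->//|]; exact: As.
apply/andP; split; apply/mem_set; first by apply: Ais; rewrite /= mem_head.
by move=> j js; apply: Ais; rewrite /= inE (js : j \in s) orbT.
Qed.

(* Once all factors but one are treated as a weight, [ge0_integral_comp_indic]
   reduces the remaining factor to an indicator; hence the mixed product. *)
Lemma iid_prod_ge0 u s1 s2 (A : nat -> set R) : uniq (s1 ++ s2) ->
  (forall i x, 0 <= u i x) -> (forall i, integrableQ (u i)) ->
  (forall i, measurable (A i)) ->
  (\int[P]_w (\prod_(i <- s1) u i (Xs i w) *
              \prod_(i <- s2) \1_(A i) (Xs i w))%R%:E)%E =
  (\prod_(i <- s1) (\int[Q]_x u i x) * \prod_(i <- s2) fine (Q (A i)))%:E.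
Proof.
move=> us u0 iu; have mu i : measurable_fun [set: R] (u i).
  by have /integrableP[/measurable_EFinP] := iu i.
have [indep lawX] := iidX.
elim: s1 s2 us A => [|k s1 ih] s2 us A mA.
  under eq_integral do rewrite big_nil mul1r prod_indicE.
  rewrite big_nil mul1r integral_indic// ?setIT; last first.
    apply: bigcap_measurableType => i _; rewrite -[X in measurable X]setTI.
    exact: measurable_funP.
  apply: (eq_trans (indep s2 A us mA)).
  rewrite (big_morph EFin EFinM erefl); apply: eq_bigr => i _.
  transitivity (Q (A i)); first exact: lawX (mA i).
  by rewrite fineK//; exact: fin_num_measure Q _ (mA i).
rewrite !big_cons.
set c := \prod_(i <- s1) (\int[Q]_x u i x) * \prod_(i <- s2) fine (Q (A i)).
have c0 : 0 <= c.
  rewrite mulr_ge0// prodr_ge0// => i _; first exact: Rintegral_ge0.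
  exact: fine_ge0.
pose M w := \prod_(i <- s1) u i (Xs i w) *
            \prod_(i <- s2) \1_(A i) (Xs i w) : R.
have k2 : k \notin s2 by move: us => /= /andP[]; rewrite mem_cat negb_or => /andP[].
have indM (B : set R) : measurable B ->
    (\int[P]_w (\1_B (Xs k w) * M w)%R%:E = mscale (NngNum c0) Q B)%E.
  (* Index [k] moves from [s1] to [s2], with the event [B], so the induction hypothesis evaluates
     the weight [M] on this event: the weighted law of [Xs k] is c times [Q]. *)
  move=> mB; pose A' i := if i == k then B else A i.
  have us' : uniq (s1 ++ k :: s2).
    by rewrite -cat1s uniq_catCA.
  have mA' i : measurable (A' i) by rewrite /A'; case: ifP.
  have A'E i : i \in s2 -> A' i = A i.
    by move=> is2; rewrite /A'; case: eqP => // ik; rewrite -ik is2 in k2.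
  have Ek : A' k = B by rewrite /A' eqxx.
  have EQ : \prod_(i <- s2) fine (Q (A' i)) = \prod_(i <- s2) fine (Q (A i)).
    by apply: eq_big_seq => i /A'E ->.
  have E1 w : \prod_(i <- s2) \1_(A' i) (Xs i w) =
              \prod_(i <- s2) \1_(A i) (Xs i w) :> R.
    by apply: eq_big_seq => i /A'E ->.
  have := ih (k :: s2) us' A' mA'.
  rewrite big_cons Ek EQ mulrCA EFinM fineK; last exact: fin_num_measure Q _ mB.
  rewrite /mscale/= muleC -/c => <-; apply: eq_integral => w _; congr EFin.
  by rewrite big_cons E1 Ek mulrCA.
transitivity (\int[P]_w ((EFin \o u k) (Xs k w) * (M w)%:E))%E.
  by apply: eq_integral => w _; rewrite big_cons /= -EFinM mulrA.
have mM : measurable_fun [set: T] M.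
  by apply: measurable_funM; apply: measurable_prod => i _;
    apply: measurableT_comp => //; exact: measurable_indic.
have mX : measurable_fun [set: T] (Xs k) by [].
rewrite (ge0_integral_comp_indic (nu := mscale (NngNum c0) Q) mX mM)//.
- rewrite ge0_integral_mscale//=; last 2 first.
  + by apply/measurable_EFinP; exact: mu.
  + by move=> x _; rewrite lee_fin.
  have -> : (\int[Q]_x (u k x)%:E = (\int[Q]_x u k x)%:E)%E.
    by apply: EFin_Rintegral; exact: iu.
  by rewrite -EFinM /c; congr EFin; ring.
- by move=> w; rewrite mulr_ge0// prodr_ge0.
- by apply/measurable_EFinP; exact: mu.
- by move=> x; rewrite lee_fin.
Qed.

Lemma iid_prod_integrable u s : uniq s -> (forall i, integrableQ (u i)) ->
  P.-integrable [set: T] (fun w => (\prod_(i <- s) u i (Xs i w))%:E).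
Proof.
move=> us iu; have mu i : measurable_fun [set: R] (u i).
  by have /integrableP[/measurable_EFinP] := iu i.
apply/integrableP; split; first by apply/measurable_EFinP; exact: measurable_integrand.
have := @iid_prod_ge0 (fun i x => `|u i x|) s [::] (fun=> set0).
rewrite cats0 => /(_ us (fun i x => normr_ge0 _)).
have iu' i : integrableQ (fun x => `|u i x|).
  exact: integrable_normQ.
move=> /(_ iu' (fun=> measurable0)).
under eq_integral do rewrite big_nil mulr1.
by under eq_integral do rewrite -normr_prod; move=> ->; rewrite ltry.
Qed.

Lemma iid_expectation_prod u s : uniq s -> (forall i, integrableQ (u i)) ->
  \int[P]_w (\prod_(i <- s) u i (Xs i w)) = \prod_(i <- s) (\int[Q]_x u i x).
Proof.
(* [s2] lists the factors already known to be nonnegative. A factor v of arbitrary sign leaves [s1]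
   by being written (|v| + v) - |v|, a difference of nonnegative integrable functions. *)
suff gen s1 s2 v : uniq (s1 ++ s2) -> (forall i, integrableQ (v i)) ->
    (forall i x, i \in s2 -> 0 <= v i x) ->
    \int[P]_w (\prod_(i <- s1 ++ s2) v i (Xs i w)) =
    \prod_(i <- s1 ++ s2) (\int[Q]_x v i x).
  by move=> us iu; have := gen s [::] u; rewrite cats0; apply.
elim: s1 s2 v => [|k s1 ih] s2 v us iv v0 /=.
  pose v' i x := `|v i x|.
  have iv' i : integrableQ (v' i) by exact: integrable_normQ.
  have := @iid_prod_ge0 v' s2 [::] (fun=> set0).
  rewrite cats0 => /(_ us (fun i x => normr_ge0 _) iv' (fun=> measurable0)).
  rewrite big_nil mulr1 => /(congr1 fine) /= E.
  transitivity (\prod_(i <- s2) \int[Q]_x v' i x).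
    rewrite -E; congr fine; apply: eq_integral => w _; rewrite big_nil mulr1; congr EFin.
    by apply: eq_big_seq => i is2; rewrite /v' ger0_norm// v0.
  apply: eq_big_seq => i is2; apply: eq_Rintegral => x _.
  by rewrite /v' ger0_norm// v0.
move: us => /= /andP[kN us].
have us' : uniq (s1 ++ k :: s2).
  by rewrite -cat1s uniq_catCA /= kN.
pose vp i x := if i == k then `|v k x| + v k x else v i x.
pose vn i x := if i == k then `|v k x| else v i x.
have ivn i : integrableQ (vn i).
  rewrite /vn; case: eqP => // _; exact: integrable_normQ.
have ivp i : integrableQ (vp i).
  rewrite /vp; case: eqP => // _; apply: integrable_addR (iv k).
  exact: integrable_normQ.
have vnE F : \prod_(i <- s1 ++ s2) F (vn i) i = \prod_(i <- s1 ++ s2) F (v i) i :> R.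
  by apply: eq_big_seq => i is12; rewrite /vn; case: eqP => // ik; rewrite -ik is12 in kN.
have vpE F : \prod_(i <- s1 ++ s2) F (vp i) i = \prod_(i <- s1 ++ s2) F (v i) i :> R.
  by apply: eq_big_seq => i is12; rewrite /vp; case: eqP => // ik; rewrite -ik is12 in kN.
have pE : perm_eq (s1 ++ k :: s2) (k :: s1 ++ s2).
  by have /permPl := perm_catCA s1 [:: k] s2.
have := ih (k :: s2) vp us' ivp; have := ih (k :: s2) vn us' ivn.
have v0n i x : i \in k :: s2 -> 0 <= vn i x.
  rewrite inE /vn; case: eqP => //= _; exact: v0.
have v0p i x : i \in k :: s2 -> 0 <= vp i x.
  rewrite inE /vp; case: eqP => //= _; last exact: v0.
  by have := ler_norm (- v k x); rewrite normrN; lra.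
move=> /(_ v0n) Hn /(_ v0p) Hp.
have inn := iid_prod_integrable us' ivn.
have inp := iid_prod_integrable us' ivp.
transitivity (\int[P]_w (\prod_(i <- s1 ++ k :: s2) vp i (Xs i w)) -
              \int[P]_w (\prod_(i <- s1 ++ k :: s2) vn i (Xs i w))).
  rewrite -RintegralB//; apply: eq_Rintegral => w _.
  rewrite !(perm_big _ pE) !big_cons /=.
  rewrite (vnE (fun f i => f (Xs i w))) (vpE (fun f i => f (Xs i w))).
  by rewrite /vn /vp eqxx; ring.
rewrite Hn Hp !(perm_big _ pE) !big_cons /=.
rewrite (vnE (fun f i => \int[Q]_x f x)) (vpE (fun f i => \int[Q]_x f x)).
rewrite -mulrBl; congr (_ * _); rewrite -RintegralB//; try by [exact: ivp|exact: ivn].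
by apply: eq_Rintegral => x _; rewrite /vn /vp eqxx; ring.
Qed.

End iid_products.

(** * Central limit theorem for sums of identically distributed variables *)

Section trigonometric_bounds.
Context {R : realType}.
Implicit Types v x : R.

Lemma is_derive_within_continuous (f df : R -> R) a b :
  (forall x, is_derive x 1 f (df x)) -> {within `[a, b], continuous f}.
Proof.
move=> fd; apply: continuous_subspaceT => x.
by apply/differentiable_continuous/derivable1_diffP; have [] := fd x.
Qed.

Lemma normr_sin_le v : `|sin v| <= `|v|.
Proof.
wlog v0 : v / 0 <= v.
  move=> H; have [/H//|/ltW v0] := leP 0 v.
  by have := H (- v); rewrite oppr_ge0 sinN !normrN; apply.
have [c _] := MVT_segment v0 (fun x _ => is_derive_sin x)
  (is_derive_within_continuous (@is_derive_sin R)).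
rewrite sin0 !subr0 => ->; rewrite normrM ler_piMl//.
by rewrite ler_norml cos_geN1 cos_le1.
Qed.

Lemma cos_half v : 1 - cos v = 2 * sin (v / 2) ^+ 2.
Proof.
have -> : v = (v / 2) *+ 2 by rewrite -mulr_natr divfK.
by rewrite cos_mulr2n -[v / 2 *+ 2]mulr_natr mulfK// cos2sin2; ring.
Qed.

(** Mean value theorem for sin x - x; a bound on 1 - cos c then gives a bound one order higher on
    sin v - v. *)
Lemma sin_sub_eq v : exists2 c, `|c| <= `|v| & sin v - v = (cos c - 1) * v.
Proof.
wlog v0 : v / 0 <= v.
  move=> H; have [/H//|/ltW v0] := leP 0 v.
  have [|c cv sc] := H (- v); rewrite ?oppr_ge0//.
  by exists c; [rewrite -(normrN v)|move: sc; rewrite sinN; lra].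
have dB x : is_derive x 1 (fun x : R => sin x - x) (cos x - 1).
  exact: is_deriveB.
have [c] := MVT_segment v0 (fun x _ => dB x) (is_derive_within_continuous dB).
rewrite in_itv/= => /andP[c0 cv]; rewrite sin0 !subr0 => E.
by exists c; rewrite ?ger0_norm.
Qed.

Lemma cos_sub1_le v : 0 <= 1 - cos v <= v ^+ 2 / 2.
Proof.
rewrite subr_ge0 cos_le1/= cos_half.
have := normr_sin_le (v / 2); rewrite -ler_sqr ?nnegrE// !real_normK ?num_real//.
rewrite expr_div_n; lra.
Qed.

Lemma cos_sub1_le_norm v : 1 - cos v <= `|v|.
Proof.
rewrite cos_half; have h1 := sin_max (v / 2); have h2 := normr_sin_le (v / 2).
rewrite normrM normfV normr_nat in h2.
rewrite -real_normK ?num_real// expr2.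
by have := normr_ge0 (sin (v / 2)); nra.
Qed.

(** This order allows domination by a second moment; [sin_sub_le3], sharper near 0, gives the
    pointwise limit. *)
Lemma sin_sub_le2 v : `|sin v - v| <= v ^+ 2.
Proof.
have [c cv ->] := sin_sub_eq v.
have c0 : 0 <= 1 - cos c by rewrite subr_ge0 cos_le1.
rewrite normrM distrC (ger0_norm c0).
rewrite -real_normK ?num_real// expr2 ler_wpM2r//.
exact: le_trans (cos_sub1_le_norm c) cv.
Qed.

Lemma sin_sub_le3 v : `|sin v - v| <= `|v| ^+ 3 / 2.
Proof.
have [c cv ->] := sin_sub_eq v.
have c0 : 0 <= 1 - cos c by rewrite subr_ge0 cos_le1.
rewrite normrM distrC (ger0_norm c0).
have /andP[_ h] := cos_sub1_le c.
rewrite exprSr mulrAC ler_wpM2r//; apply: le_trans h _.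
by rewrite ler_pM2r// -real_normK ?num_real// ler_sqr ?nnegrE.
Qed.

(** With a = v / 2 the difference is 2 (sin^2 a - a^2), the product of a factor of order a^3 and one
    of order a. *)
Lemma cos_sub2_le v : `|1 - cos v - v ^+ 2 / 2| <= v ^+ 4.
Proof.
set a := v / 2; have -> : 1 - cos v - v ^+ 2 / 2 = 2 * (sin a - a) * (sin a + a).
  by rewrite cos_half -/a (_ : v ^+ 2 = 4 * a ^+ 2) /a; field.
rewrite !normrM (ger0_norm (ler0n _ 2)).
have h1 := sin_sub_le3 a.
have h2 : `|sin a + a| <= 2 * `|a|.
  by apply: le_trans (ler_normD _ _) _; have := normr_sin_le a; lra.
have -> : v ^+ 4 = 16 * `|a| ^+ 4.
  rewrite -normrX ger0_norm; last by rewrite exprn_even_ge0.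
  by rewrite /a; field.
apply: (@le_trans _ _ (2 * (`|a| ^+ 3 / 2) * (2 * `|a|))).
  by apply: ler_pM => //; rewrite ler_pM2l.
have -> : 2 * (`|a| ^+ 3 / 2) * (2 * `|a|) = 2 * `|a| ^+ 4 by field.
by rewrite ler_wpM2r ?exprn_ge0// ler_nat.
Qed.

(** The upper bound comes from exp (-x) <= 1 / (1 + x), since 1 / (1 + x) - 1 + x = x^2 / (1 +
    x). *)
Lemma expR_sub_le x : 0 <= x -> 0 <= expR (- x) - 1 + x <= x ^+ 2.
Proof.
move=> x0; have := expR_ge1Dx (- x) => h1.
have h2 : expR (- x) <= (1 + x)^-1.
  rewrite expRN lef_pV2 ?posrE ?expR_gt0//; last by lra.
  exact: expR_ge1Dx.
apply/andP; split; first by lra.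
apply: (@le_trans _ _ ((1 + x)^-1 - 1 + x)); first by lra.
have p : 0 < 1 + x by lra.
have -> : (1 + x)^-1 - 1 + x = x ^+ 2 / (1 + x) by field; rewrite gt_eqF.
rewrite ler_pdivrMr//; have := sqr_ge0 x; nra.
Qed.

Lemma measurable_cos : measurable_fun [set: R] (@cos R).
Proof. by apply: continuous_measurable_fun; exact: continuous_cos. Qed.

Lemma measurable_sin : measurable_fun [set: R] (@sin R).
Proof. by apply: continuous_measurable_fun; exact: continuous_sin. Qed.

Lemma cvg_dist_le (u e : nat -> R) (l : R) :
  (forall n, (0 < n)%N -> `|u n - l| <= e n) ->
  e n @[n --> \oo] --> 0 -> u n @[n --> \oo] --> l.
Proof.
move=> ue /cvgrPdist_le e0; apply/cvgrPdist_le => d d0.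
apply: filterS2 (nbhs_infty_gt 0) (e0 d d0) => n n0; rewrite sub0r normrN => h.
by rewrite distrC; apply: le_trans (ue n n0) (le_trans (ler_norm _) h).
Qed.

Lemma cvg_inv_nat (a : R) : a / n%:R @[n --> \oo] --> (0 : R).
Proof.
rewrite -[X in _ --> X](mulr0 a); apply: cvgMr.
rewrite -cvg_shiftS; exact: cvg_harmonic.
Qed.

Lemma cvg_inv_sqrt (a : R) : a / Num.sqrt n%:R @[n --> \oo] --> (0 : R).
Proof.
rewrite -[X in _ --> X](mulr0 a); apply: cvgMr.
have -> : (fun n => (Num.sqrt n%:R)^-1) = Num.sqrt \o (fun n => (n%:R)^-1 : R).
  by apply/funext => n /=; rewrite sqrtrV.
rewrite -[X in _ --> X]sqrtr0; apply: continuous_cvg; first exact: sqrt_continuous.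
by have := @cvg_inv_nat 1; under eq_fun do rewrite mul1r.
Qed.

End trigonometric_bounds.

Lemma cvg_Rintegral_dominated {R : realType} d (T : measurableType d)
    (P : probability T R) (f_ : nat -> T -> R) (f g : T -> R) :
  (forall n, measurable_fun [set: T] (f_ n)) ->
  measurable_fun [set: T] f ->
  (forall x, f_ n x @[n --> \oo] --> f x) ->
  P.-integrable [set: T] (EFin \o g) ->
  (forall n x, `|f_ n x| <= g x) ->
  \int[P]_x f_ n x @[n --> \oo] --> \int[P]_x f x.
Proof.
move=> mf_ mf ff ig fg.
have [|||||fi _ H] := @dominated_convergence _ _ _ P _ measurableT
  (fun n => EFin \o f_ n) (EFin \o f) (EFin \o g).
- by move=> n; apply/measurable_EFinP.
- by apply/measurable_EFinP.
- by apply: aeW => x _; apply: cvg_EFin => //; [exact: nearW|exact: ff].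
- exact: ig.
- by apply: aeW => x n _ /=; rewrite lee_fin.
have -> : \int[P]_x f x = fine (\int[P]_x (f x)%:E) by [].
apply: (@fine_cvg _ _ _ _ (fun n => \int[P]_x (f_ n x)%:E)%E).
rewrite EFin_Rintegral//= in H *.
Qed.

(* The real and imaginary parts of (C + i S)^n. *)
Fixpoint rotation {R : realType} (C S : R) (n : nat) : R * R :=
  if n is m.+1 then
    let: (c, s) := rotation C S m in (c * C - s * S, s * C + c * S)
  else (1, 0).

Section rotation_limit.
Context {R : realType}.

(** Real form of |z^n - w^n| <= n |z - w| for z = C + i S and w in the unit disc. The bound |z^n| <=
    1 is carried along in the induction because each step uses it. *)
Lemma rotation_bound (C S w : R) n : 0 <= w <= 1 ->
  C ^+ 2 + S ^+ 2 <= 1 ->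
  `|(rotation C S n).1 - w ^+ n| <= n%:R * (`|C - w| + `|S|) /\
  `|(rotation C S n).2| <= n%:R * `|S|.
Proof.
move=> /andP[w0 w1] CS.
have sq1 (x y : R) : x ^+ 2 + y ^+ 2 <= 1 -> `|x| <= 1.
  move=> xy; rewrite -ler_sqr ?nnegrE// expr1n real_normK ?num_real//.
  by have := sqr_ge0 y; lra.
have C1 := sq1 _ _ CS.
have /sq1 S1 : S ^+ 2 + C ^+ 2 <= 1 by rewrite addrC.
suff [H1 [H2 _]] : `|(rotation C S n).1 - w ^+ n| <= n%:R * (`|C - w| + `|S|) /\
    `|(rotation C S n).2| <= n%:R * `|S| /\
    (rotation C S n).1 ^+ 2 + (rotation C S n).2 ^+ 2 <= 1 by [].
elim: n => [|n] /=; first by rewrite expr0 subrr normr0 !mul0r expr1n expr0n addr0.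
case: rotation => c s /= [H1 [H2 H3]].
have c1 := sq1 _ _ H3.
have /sq1 s1 : s ^+ 2 + c ^+ 2 <= 1 by rewrite addrC.
split; [|split].
- have -> : c * C - s * S - w ^+ n.+1 =
      c * (C - w) + (w * (c - w ^+ n) - s * S) by rewrite exprS; ring.
  apply: le_trans (ler_normD _ _) _; apply: (@le_trans _ _
    (`|C - w| + (`|c - w ^+ n| + `|S|))).
    apply: lerD; first by rewrite normrM ler_piMl.
    apply: le_trans (ler_normB _ _) _; apply: lerD; rewrite normrM.
      by rewrite ler_piMl// ger0_norm.
    by rewrite ler_piMl.
  by rewrite -natr1; lra.
- apply: le_trans (ler_normD _ _) _; apply: (@le_trans _ _ (`|s| + `|S|)).
    by apply: lerD; rewrite normrM; [rewrite ler_piMr|rewrite ler_piMl].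
  by rewrite -natr1; lra.
- have -> : (c * C - s * S) ^+ 2 + (s * C + c * S) ^+ 2 =
    (c ^+ 2 + s ^+ 2) * (C ^+ 2 + S ^+ 2) by ring.
  by rewrite mulr_ile1// addr_ge0 ?sqr_ge0.
Qed.

(** C + i S is compared with w = exp (-v / n), whose n-th power is exactly the limit; the hypotheses
    make the error n (|C - w| + |S|) vanish. *)
Lemma rotation_cvg (C S : nat -> R) (v : R) : 0 <= v ->
  (forall n, C n ^+ 2 + S n ^+ 2 <= 1) ->
  n%:R * (1 - C n) @[n --> \oo] --> v ->
  n%:R * S n @[n --> \oo] --> 0 ->
  (rotation (C n) (S n) n).1 @[n --> \oo] --> expR (- v) /\
  (rotation (C n) (S n) n).2 @[n --> \oo] --> 0.
Proof.
move=> v0 CS Cv S0.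
have nS0 : n%:R * `|S n| @[n --> \oo] --> 0.
  have := cvg_norm S0; rewrite normr0.
  have -> : (fun n => `|n%:R * S n|) = (fun n => n%:R * `|S n|).
    by apply/funext => n; rewrite normrM normr_nat.
  exact.
pose w n := expR (- (v / n%:R)).
have w01 n : 0 <= w n <= 1.
  by rewrite expR_ge0/= -expR0 ler_expR oppr_le0 divr_ge0.
have wn n : (0 < n)%N -> w n ^+ n = expR (- v).
  by move=> n0; rewrite -expRM_natl mulrN mulrC divfK ?pnatr_eq0 -?lt0n.
have nw n : (0 < n)%N -> `|n%:R * (1 - w n) - v| <= v ^+ 2 / n%:R.
  move=> n0; have n0R : 0 < n%:R :> R by rewrite ltr0n.
  have /andP[h1 h2] := @expR_sub_le _ (v / n%:R) (divr_ge0 v0 (ltW n0R)).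
  have -> : n%:R * (1 - w n) - v = - (n%:R * (w n - 1 + v / n%:R)).
    by field; rewrite gt_eqF.
  rewrite normrN normrM normr_nat (ger0_norm h1).
  apply: (@le_trans _ _ (n%:R * (v / n%:R) ^+ 2)).
    by rewrite ler_pM2l.
  rewrite le_eqVlt; apply/orP; left; apply/eqP; field.
  by rewrite gt_eqF.
have H n := rotation_bound n (w01 n) (CS n).
split; last first.
  by apply: cvg_dist_le nS0 => n n0; rewrite subr0; have [] := H n.
pose e n := `|n%:R * (1 - C n) - v| + v ^+ 2 / n%:R + n%:R * `|S n|.
have e0 : e n @[n --> \oo] --> 0.
  rewrite -[X in _ --> X](addr0 0); apply: cvgD => //.
  rewrite -[X in _ --> X](addr0 0); apply: cvgD; last exact: cvg_inv_nat.
  rewrite -[X in _ --> X](@normr0 _ R) -(subrr v); apply: cvg_norm.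
  by apply: cvgB => //; exact: cvg_cst.
apply: cvg_dist_le e0 => n n0; rewrite -(wn n n0).
apply: le_trans (H n).1 _; rewrite mulrDr /e lerD2r -(normr_nat R n) -normrM.
rewrite (_ : n%:R * (C n - w n) =
  (n%:R * (1 - w n) - v) - (n%:R * (1 - C n) - v)); last by ring.
rewrite normr_nat; apply: le_trans (ler_normB _ _) _.
by rewrite addrC lerD2l; exact: nw.
Qed.

End rotation_limit.

Section characteristic_function_of_sums.
Context {R : realType} (Q : probability (measurableTypeR R) R).

Lemma integrable_cos d (T : measurableType d) (P : probability T R)
  (h : T -> R) : measurable_fun [set: T] h ->
  P.-integrable [set: T] (EFin \o (fun x => cos (h x))).
Proof.
move=> mh; apply: (@integrable_boundedR _ _ _ _ _ 1).
  exact: measurableT_comp measurable_cos mh.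
by move=> x; rewrite ler_norml cos_geN1 cos_le1.
Qed.

Lemma integrable_sin d (T : measurableType d) (P : probability T R)
  (h : T -> R) : measurable_fun [set: T] h ->
  P.-integrable [set: T] (EFin \o (fun x => sin (h x))).
Proof.
move=> mh; apply: (@integrable_boundedR _ _ _ _ _ 1).
  exact: measurableT_comp measurable_sin mh.
by move=> x; rewrite ler_norml sin_geN1 sin_le1.
Qed.

(** The integral of (C - cos h)^2 + (S - sin h)^2 is nonnegative and equals 1 - C^2 - S^2. *)
Lemma cos_sin_sqr_le1 (h : R -> R) : measurable_fun [set: R] h ->
  (\int[Q]_x cos (h x)) ^+ 2 + (\int[Q]_x sin (h x)) ^+ 2 <= 1.
Proof.
move=> mh; set C := (\int[Q]_x cos (h x)); set S := (\int[Q]_x sin (h x)).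
have ic : Q.-integrable [set: R] (EFin \o (fun x => cos (h x))) := integrable_cos Q mh.
have is_ : Q.-integrable [set: R] (EFin \o (fun x => sin (h x))) := integrable_sin Q mh.
suff : 0 <= \int[Q]_x (1 + (C ^+ 2 + S ^+ 2) - 2 * (C * cos (h x) + S * sin (h x))).
  have i1 : Q.-integrable [set: R]
      (EFin \o (fun x => C * cos (h x) + S * sin (h x))).
    by apply: integrable_addR; exact: integrable_scaleR.
  rewrite RintegralB//; last 2 first.
  - exact: finite_measure_integrable_cst.
  - exact: (integrable_scaleR 2 i1).
  rewrite Rintegral_cstR RintegralZl// RintegralD//; last 2 first.
  - exact: (integrable_scaleR _ ic).
  - exact: (integrable_scaleR _ is_).
  rewrite !RintegralZl// -/C -/S; lra.
apply: Rintegral_ge0 => x _.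
have -> : 1 + (C ^+ 2 + S ^+ 2) - 2 * (C * cos (h x) + S * sin (h x)) =
    (C - cos (h x)) ^+ 2 + (S - sin (h x)) ^+ 2.
  by have := cos2Dsin2 (h x) => E; rewrite -[X in X + _ - _]E; ring.
by rewrite addr_ge0 ?sqr_ge0.
Qed.

Lemma rotation_clt (psi : R -> R) : L2_centered Q psi ->
  let C n := \int[Q]_x cos (psi x / Num.sqrt n%:R) in
  let S n := \int[Q]_x sin (psi x / Num.sqrt n%:R) in
  (rotation (C n) (S n) n).1 @[n --> \oo] --> expR (- (inner Q psi psi / 2)) /\
  (rotation (C n) (S n) n).2 @[n --> \oo] --> 0.
Proof.
move=> [psiL psi0] C S; have mpsi := L2_measurable psiL.
have [_ ipsi2] := (L2P Q psi).1 psiL.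
have ipsi := L2_integrable psiL.
have mps n : measurable_fun [set: R] (fun x => psi x / Num.sqrt n%:R).
  by apply: measurable_funM.
have sq n y : (0 < n)%N -> n%:R * (y / Num.sqrt n%:R) ^+ 2 = y ^+ 2 :> R.
  move=> n0; rewrite expr_div_n sqr_sqrtr// mulrC divfK//.
  by rewrite pnatr_eq0 -lt0n.
(* Also valid at n = 0, where the quotient is 0 by convention: domination is required for every
   n. *)
have sq' n y : n%:R * (y / Num.sqrt n%:R) ^+ 2 <= y ^+ 2 :> R.
  have [->|n0] := posnP n; first by rewrite mul0r sqr_ge0.
  by rewrite sq.
apply: rotation_cvg.
- by rewrite divr_ge0// inner_ge0.
- by move=> n; exact: cos_sin_sqr_le1.
- have -> : (fun n => n%:R * (1 - C n)) = fun n =>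
     \int[Q]_x (n%:R * (1 - cos (psi x / Num.sqrt n%:R))).
    apply/funext => n; have ic := integrable_cos Q (mps n).
    have i1 : Q.-integrable [set: R] (EFin \o cst (1 : R)).
      exact: finite_measure_integrable_cst.
    rewrite RintegralZl//; last exact: (integrable_subR i1 ic).
    by rewrite RintegralB// Rintegral_cstR.
  rewrite (_ : inner Q psi psi / 2 = \int[Q]_x (psi x ^+ 2 / 2)); last first.
    by rewrite /inner RintegralZr.
  apply: (cvg_Rintegral_dominated _ _ _ ipsi2).
  + move=> n; apply: measurable_funM => //; apply: measurable_funB => //.
    exact: measurableT_comp measurable_cos (mps n).
  + by apply: measurable_funM => //; exact: measurable_funX.
  + move=> x; apply: (cvg_dist_le _ (cvg_inv_nat (psi x ^+ 4))) => n n0.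
    set v := psi x / Num.sqrt n%:R.
    have n0R : 0 < n%:R :> R by rewrite ltr0n.
    have vE : psi x ^+ 2 = n%:R * v ^+ 2 by rewrite sq.
    have -> : n%:R * (1 - cos v) - psi x ^+ 2 / 2 =
        n%:R * (1 - cos v - v ^+ 2 / 2) by rewrite vE; field.
    have -> : psi x ^+ 4 / n%:R = n%:R * v ^+ 4.
      rewrite (exprM _ 2 2) vE; field; rewrite gt_eqF//.
    by rewrite normrM normr_nat ler_pM2l// cos_sub2_le.
  + move=> n x; set v := psi x / Num.sqrt n%:R.
    have /andP[h1 h2] := cos_sub1_le v.
    rewrite normrM normr_nat (ger0_norm h1).
    apply: le_trans (sq' n (psi x)); rewrite -/v ler_wpM2l//.
    by have := sqr_ge0 v; lra.
(* As psi has mean 0, subtracting its linear term leaves the integral unchanged and makes the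
   integrand dominated by psi^2. *)
- have -> : (fun n => n%:R * S n) = fun n => \int[Q]_x
     (n%:R * (sin (psi x / Num.sqrt n%:R) - psi x / Num.sqrt n%:R)).
    apply/funext => n; have is_ := integrable_sin Q (mps n).
    have i1 : Q.-integrable [set: R] (EFin \o (fun x => psi x / Num.sqrt n%:R)).
      have := integrable_scaleR (Num.sqrt n%:R)^-1 ipsi.
      by congr integrable; apply/funext => x /=; rewrite mulrC.
    rewrite RintegralZl//; last exact: (integrable_subR is_ i1).
    rewrite RintegralB// RintegralZr//.
    move: psi0; rewrite /inner; under eq_Rintegral do rewrite mulr1.
    by move=> ->; rewrite mul0r subr0.
  rewrite -[X in _ --> X](Rintegral_cstR Q).
  apply: (cvg_Rintegral_dominated _ _ _ ipsi2).
  + move=> n; apply: measurable_funM => //; apply: measurable_funB => //.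
    exact: measurableT_comp measurable_sin (mps n).
    exact: mps n.
  + by [].
  + move=> x; apply: (cvg_dist_le _ (cvg_inv_sqrt (`|psi x| ^+ 3))) => n n0.
    rewrite subr0; set v := psi x / Num.sqrt n%:R.
    have s0 : 0 < Num.sqrt n%:R :> R by rewrite sqrtr_gt0 ltr0n.
    rewrite normrM normr_nat.
    apply: (@le_trans _ _ (n%:R * (`|v| ^+ 3 / 2))).
      by rewrite ler_wpM2l// sin_sub_le3.
    have -> : `|psi x| ^+ 3 / Num.sqrt n%:R = n%:R * `|v| ^+ 3.
      rewrite /v normrM normfV (gtr0_norm s0).
      have := sqr_sqrtr (ler0n R n); move: s0; move: (Num.sqrt _) => r r0 <-.
      by field; rewrite gt_eqF.
    rewrite ler_wpM2l//; have : 0 <= `|v| ^+ 3 by rewrite exprn_ge0.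
    lra.
  + move=> n x; set v := psi x / Num.sqrt n%:R.
    rewrite normrM normr_nat; apply: le_trans (sq' n (psi x)).
    by rewrite -/v ler_wpM2l// sin_sub_le2.
Qed.

End characteristic_function_of_sums.

Section iid_sums.
Context {R : realType} d (T : measurableType d) (P : probability T R).
Variables (Xs : nat -> {RV P >-> R}) (Q : probability (measurableTypeR R) R).
Hypothesis iidX : iid Xs Q.

Lemma iid_cos_sin_sum (th : R -> R) (n : nat) : measurable_fun [set: R] th ->
  let C := \int[Q]_x cos (th x) in let S := \int[Q]_x sin (th x) in
  \int[P]_w cos (\sum_(i < n) th (Xs i w)) = (rotation C S n).1 /\
  \int[P]_w sin (\sum_(i < n) th (Xs i w)) = (rotation C S n).2.
Proof.
move=> mth C S.
have mX i : measurable_fun [set: T] (Xs i) by [].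
have mS k : measurable_fun [set: T] (fun w => \sum_(i < k) th (Xs i w)).
  by apply: measurable_sum => i; apply: measurableT_comp mth (mX i).
have mcos f : measurable_fun [set: T] f -> measurable_fun [set: T] (fun w => cos (f w)).
  by move=> mf; exact: measurableT_comp measurable_cos mf.
have msin f : measurable_fun [set: T] f -> measurable_fun [set: T] (fun w => sin (f w)).
  by move=> mf; exact: measurableT_comp measurable_sin mf.
(* The addition formulas split off the cosine or sine of the last term. These join a product over
   the indices of [s], all at least k, and this is what closes the induction. *)
suff gen (k : nat) (s : seq nat) (u : nat -> R -> R) : uniq s ->
    all (leq k) s -> (forall i, Q.-integrable [set: R] (EFin \o u i)) ->
    \int[P]_w (cos (\sum_(i < k) th (Xs i w)) * \prod_(i <- s) u i (Xs i w)) =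
      (rotation C S k).1 * \prod_(i <- s) \int[Q]_x u i x /\
    \int[P]_w (sin (\sum_(i < k) th (Xs i w)) * \prod_(i <- s) u i (Xs i w)) =
      (rotation C S k).2 * \prod_(i <- s) \int[Q]_x u i x.
  have [||i|] := gen n [::] (fun=> cst 1) => //.
    exact: finite_measure_integrable_cst.
  rewrite big_nil !mulr1 => <- <-.
  by split; apply: eq_Rintegral => w _; rewrite big_nil mulr1.
elim: k s u => [|k ih] s u us ks iu.
  rewrite /= mul1r mul0r; split.
    rewrite -(iid_expectation_prod iidX us iu); apply: eq_Rintegral => w _.
    by rewrite big_ord0 cos0 mul1r.
  transitivity (\int[P]_w (0 : R)); last by rewrite Rintegral_cstR.
  by apply: eq_Rintegral => w _; rewrite big_ord0 sin0 mul0r.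
have kN : k \notin s by apply/negP => /(allP ks); rewrite ltnn.
have us' : uniq (k :: s) by rewrite /= kN.
have ks' : all (leq k) (k :: s).
  by rewrite /= leqnn; apply/allP => i /(allP ks)/ltnW.
pose uc i : R -> R := if i == k then cos \o th else u i.
pose us_ i : R -> R := if i == k then sin \o th else u i.
have iuc i : Q.-integrable [set: R] (EFin \o uc i).
  by rewrite /uc; case: eqP => // _; exact: (integrable_cos Q mth).
have ius i : Q.-integrable [set: R] (EFin \o us_ i).
  by rewrite /us_; case: eqP => // _; exact: (integrable_sin Q mth).
have ucE (F : (R -> R) -> nat -> R) :
    \prod_(i <- k :: s) F (uc i) i = F (cos \o th) k * \prod_(i <- s) F (u i) i.
  rewrite big_cons {1}/uc eqxx; congr (_ * _); apply: eq_big_seq => i is_.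
  by rewrite /uc; case: eqP => // ik; rewrite -ik is_ in kN.
have usE (F : (R -> R) -> nat -> R) :
    \prod_(i <- k :: s) F (us_ i) i = F (sin \o th) k * \prod_(i <- s) F (u i) i.
  rewrite big_cons {1}/us_ eqxx; congr (_ * _); apply: eq_big_seq => i is_.
  by rewrite /us_; case: eqP => // ik; rewrite -ik is_ in kN.
have [cc sc] := ih _ _ us' ks' iuc; have [cs ss] := ih _ _ us' ks' ius.
move: cc sc cs ss.
rewrite (ucE (fun f i => \int[Q]_x f x)) (usE (fun f i => \int[Q]_x f x)).
set p := \prod_(i <- s) \int[Q]_x u i x.
pose M w := \prod_(i <- s) u i (Xs i w).
have ucM w : \prod_(i <- k :: s) uc i (Xs i w) = cos (th (Xs k w)) * M w.
  exact: (ucE (fun f i => f (Xs i w))).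
have usM w : \prod_(i <- k :: s) us_ i (Xs i w) = sin (th (Xs k w)) * M w.
  exact: (usE (fun f i => f (Xs i w))).
under eq_Rintegral do rewrite ucM.
move=> cc; under eq_Rintegral do rewrite ucM.
move=> sc; under eq_Rintegral do rewrite usM.
move=> cs; under eq_Rintegral do rewrite usM.
move=> ss.
have iM := iid_prod_integrable iidX us iu.
have I (f g : T -> R) : measurable_fun [set: T] f -> (forall w, `|f w| <= 1) ->
    measurable_fun [set: T] g -> (forall w, `|g w| <= 1) ->
    P.-integrable [set: T] (EFin \o (fun w => f w * (g w * M w))).
  move=> mf f1 mg g1.
  apply: (@integrable_dominatedR _ _ _ _ _ (fun w => `|M w|)).
  - apply: measurable_funM => //; apply: measurable_funM => //.
    exact: integrable_measurable iM.
  - exact: integrable_abse iM.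
  - move=> w; rewrite !normrM; apply: (@le_trans _ _ (1 * (1 * `|M w|))).
      by do 2 apply: ler_pM => //; rewrite ?mulr_ge0.
    by rewrite !mul1r.
have c1 (x : R) : `|cos x| <= 1 by rewrite ler_norml cos_geN1 cos_le1.
have s1 (x : R) : `|sin x| <= 1 by rewrite ler_norml sin_geN1 sin_le1.
have mk : measurable_fun [set: T] (fun w => th (Xs k w)).
  exact: measurableT_comp mth (mX k).
rewrite /=; case: rotation cc sc cs ss => c0 s0 /= cc sc cs ss.
split.
- transitivity (\int[P]_w (cos (\sum_(i < k) th (Xs i w)) * (cos (th (Xs k w)) * M w)) -
                \int[P]_w (sin (\sum_(i < k) th (Xs i w)) * (sin (th (Xs k w)) * M w))).
    rewrite -RintegralB//; try by apply: I => //; auto.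
    by apply: eq_Rintegral => w _; rewrite big_ord_recr/= cosD -/(M w); ring.
  by rewrite cc ss /C /S; ring.
- transitivity (\int[P]_w (sin (\sum_(i < k) th (Xs i w)) * (cos (th (Xs k w)) * M w)) +
                \int[P]_w (cos (\sum_(i < k) th (Xs i w)) * (sin (th (Xs k w)) * M w))).
    rewrite -RintegralD//; try by apply: I => //; auto.
    by apply: eq_Rintegral => w _; rewrite big_ord_recr/= sinD -/(M w); ring.
  by rewrite sc cs /C /S; ring.
Qed.

(** Cross terms vanish by independence and centering. After normalization this is the second moment
    bound that is uniform in n. *)
Lemma iid_sum_sqr (psi : R -> R) (n : nat) : L2_centered Q psi ->
  P.-integrable [set: T] (EFin \o (fun w => (\sum_(i < n) psi (Xs i w)) ^+ 2)) /\
  \int[P]_w ((\sum_(i < n) psi (Xs i w)) ^+ 2) = n%:R * inner Q psi psi.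
Proof.
move=> [psiL psi0].
have ipsi := L2_integrable psiL.
have ipsi2 : Q.-integrable [set: R] (EFin \o (fun x => psi x * psi x)).
  exact: L2_mul_integrable.
have E0 : \int[Q]_x psi x = 0.
  by move: psi0; rewrite /inner; under eq_Rintegral do rewrite mulr1.
have sqE w : (\sum_(i < n) psi (Xs i w)) ^+ 2 =
    \sum_(i < n) \sum_(j < n) psi (Xs i w) * psi (Xs j w).
  by rewrite expr2 big_distrl/=; apply: eq_bigr => i _; rewrite big_distrr.
have pair (i j : 'I_n) :
    P.-integrable [set: T] (EFin \o (fun w => psi (Xs i w) * psi (Xs j w))) /\
    \int[P]_w (psi (Xs i w) * psi (Xs j w)) = (i == j)%:R * inner Q psi psi.
  have [->|ij] := eqVneq i j.
    have u1 : uniq [:: nat_of_ord j] by [].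
    have iu (k : nat) := ipsi2.
    have := iid_prod_integrable iidX u1 iu.
    under eq_fun do rewrite big_seq1.
    move=> i1; split=> //; have := iid_expectation_prod iidX u1 iu.
    rewrite big_seq1 mul1r /inner => <-.
    by apply: eq_Rintegral => w _; rewrite big_seq1.
  have u2 : uniq [:: nat_of_ord i; nat_of_ord j] by rewrite /= inE andbT.
  have iu (k : nat) := ipsi.
  have := iid_prod_integrable iidX u2 iu.
  under eq_fun do rewrite !big_cons big_nil mulr1.
  move=> i2; split=> //; have := iid_expectation_prod iidX u2 iu.
  rewrite !big_cons big_nil E0 !mul0r => <-.
  by apply: eq_Rintegral => w _; rewrite !big_cons big_nil mulr1.
have int2 i := @integrable_sumR _ _ _ P _ (index_enum 'I_n) _ (fun j => (pair i j).1).
split.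
  under eq_fun do rewrite sqE.
  exact: (@integrable_sumR _ _ _ P _ (index_enum 'I_n) _ int2).
under eq_Rintegral do rewrite sqE.
rewrite (@Rintegral_sumR _ _ _ P _ (index_enum 'I_n) _ int2).
rewrite -[n in RHS]card_ord -sum1_card natr_sum mulr_suml; apply: eq_bigr => i _.
rewrite (@Rintegral_sumR _ _ _ P _ (index_enum 'I_n) _ (fun j => (pair i j).1)).
rewrite (bigD1 i)//= (pair i i).2 eqxx big1 ?addr0//.
by move=> j ji; rewrite (pair i j).2 eq_sym (negbTE ji) mul0r.
Qed.

End iid_sums.

(** * Gaussian vectors *)

Section gaussian_law.
Context {R : realType}.
Notation lambda := (@lebesgue_measure R).
Let N : probability (measurableTypeR R) R := normal_prob 0 1.
Notation pdf := (@normal_pdf R 0 1).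

Lemma normal_integral (u : measurableTypeR R -> \bar R) :
  measurable_fun [set: measurableTypeR R] u -> (forall y, 0 <= u y)%E ->
  (\int[N]_y u y = \int[lambda]_x (u x * (pdf x)%:E))%E.
Proof.
move=> mu u0; apply/esym.
apply: (@ge0_integral_comp_indic _ _ _ _ _ lambda N idfun pdf u) => //.
- exact: measurable_id.
- exact: measurable_normal_pdf.
- by move=> x; exact: normal_pdf_ge0.
move=> A mA; rewrite /N /= /normal_prob [RHS]integral_mkcond.
apply: eq_integral => x _; rewrite !patchE /= indicE.
by case: (x \in A); rewrite ?mul1r ?mul0r.
Qed.

Lemma normal01E x : pdf x = (Num.sqrt (pi *+ 2))^-1 * expR (- x ^+ 2 / 2).
Proof.
rewrite normal_pdfE ?oner_eq0// /normal_peak /normal_fun.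
by rewrite expr1n mul1r subr0.
Qed.

Lemma normal_sqr_integrable : L2 N idfun.
Proof.
apply/L2P; split; first exact: measurable_id.
apply/integrableP; split.
  by apply/measurable_EFinP; apply: measurable_funX; exact: measurable_id.
under eq_integral do rewrite /= ger0_norm ?sqr_ge0//.
rewrite normal_integral; last 2 first.
- by apply/measurable_EFinP; apply: measurable_funX; exact: measurable_id.
- by move=> y; rewrite lee_fin sqr_ge0.
(* From x^2 <= 8 exp (x^2 / 8), the integrand is at most a multiple of exp (-x^2 / 8), the shape of
   the normal density of standard deviation 2; the other factors of c exchange the two
   normalizations. *)
pose c : R := 8 * (Num.sqrt (pi *+ 2))^-1 * (normal_peak 2)^-1.
have ib := integrableZl measurableT c (integrable_normal_pdf (0 : R) 2).
have /integrableP[_] := ib; apply: le_lt_trans; apply: ge0_le_integral => //.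
- by move=> x _; rewrite lee_fin mulr_ge0 ?sqr_ge0 ?normal_pdf_ge0.
- apply/measurable_EFinP/measurable_funM; last exact: measurable_normal_pdf.
  by apply: measurable_funX; exact: measurable_id.
- apply/measurable_EFinP; apply: measurableT_comp => //.
  by apply: measurable_funM => //; exact: measurable_normal_pdf.
- move=> x _ /=; rewrite lee_fin; apply: le_trans (ler_norm _).
  rewrite normal01E normal_pdfE// /normal_fun subr0 /c.
  have p2 : normal_peak (2 : R) != 0 by rewrite gt_eqF// normal_peak_gt0.
  set s := (Num.sqrt _)^-1; have s0 : 0 <= s by rewrite invr_ge0.
  have -> : 8 * s * (normal_peak 2)^-1 *
      (normal_peak 2 * expR (- x ^+ 2 / (2 ^+ 2 *+ 2))) =
      s * (8 * expR (- x ^+ 2 / 8)).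
    by rewrite (_ : 2 ^+ 2 *+ 2 = 8 :> R); [field|ring].
  rewrite mulrCA ler_wpM2l//.
  have h := expR_ge1Dx (x ^+ 2 / 8).
  apply: (@le_trans _ _ (8 * expR (x ^+ 2 / 8) * expR (- x ^+ 2 / 2))).
    by rewrite ler_wpM2r ?expR_ge0//; lra.
  rewrite -mulrA -expRD ler_pM2l// ler_expR.
  by have := sqr_ge0 x; lra.
Qed.

Lemma lebesgue_reflection (f : R -> \bar R) : measurable_fun [set: R] f ->
  (forall x, 0 <= f x)%E ->
  (\int[lambda]_x f x = \int[lambda]_x f (- x)%R)%E.
Proof.
move=> mf f0.
have mN : measurable_fun [set: R] (fun x => f (- x)).
  by apply: measurableT_comp mf _; apply: continuous_measurable_fun; exact: opp_continuous.
have split g : measurable_fun [set: R] g -> (forall x, 0 <= g x)%E ->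
    (\int[lambda]_x g x = \int[lambda]_(x in `]-oo, 0%R]) g x +
      \int[lambda]_(x in `[0%R, +oo[) g x)%E.
  move=> mg g0; rewrite -(setvU `]-oo, (0 : R)]) ge0_integral_setU//=.
  - rewrite addeC; congr (_ + _)%E; rewrite setCitvl integral_itv_obnd_cbnd//.
    exact: measurable_funTS.
  - by apply: measurableC.
  - exact: measurable_funTS.
  - by apply/disj_setPS => x []/=.
rewrite split// (split (fun x => f (- x)))//.
rewrite (ge0_integration_by_substitution0 mf f0).
rewrite (ge0_integration_by_substitution0 mN) => [|x]; last exact: f0.
rewrite addeC; congr (_ + _)%E.
by apply: eq_integral => x _; rewrite opprK.
Qed.

Lemma normal_reflection (f : R -> R) : measurable_fun [set: R] f ->
  (forall x, 0 <= f x) -> \int[N]_x f x = \int[N]_x f (- x).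
Proof.
move=> mf f0; rewrite /Rintegral; congr fine.
have mN : measurable_fun [set: R] (fun x => f (- x)).
  by apply: measurableT_comp mf _; apply: continuous_measurable_fun; exact: opp_continuous.
rewrite !normal_integral//; try by [move=> y; rewrite lee_fin|apply/measurable_EFinP].
rewrite lebesgue_reflection.
- apply: eq_integral => x _; congr (_ * _%:E)%E.
  by rewrite !normal01E sqrrN.
- apply/measurable_EFinP/measurable_funM => //; exact: measurable_normal_pdf.
- by move=> x; rewrite lee_fin mulr_ge0// normal_pdf_ge0.
Qed.

Lemma normal_centered : L2_centered N idfun.
Proof.
have L := normal_sqr_integrable; split=> //.
rewrite /inner; under eq_Rintegral do rewrite mulr1.
have [_ i2] := (L2P _ _).1 L; have i1 := L2_integrable L.
have i0 : N.-integrable [set: R] (EFin \o cst (1 : R)).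
  exact: finite_measure_integrable_cst.
(* [normal_reflection] is about nonnegative functions, so x is replaced by 1 + x^2 + x, which
   reflection turns into 1 + x^2 - x. *)
have E a : \int[N]_x (1 + (x ^+ 2 + a * x)) =
    1 + (\int[N]_x x ^+ 2 + a * \int[N]_x x).
  rewrite RintegralD//; last exact: (integrable_addR i2 (integrable_scaleR a i1)).
  rewrite Rintegral_cstR RintegralD//; last exact: (integrable_scaleR a i1).
  by rewrite RintegralZl.
have m1 a : measurable_fun [set: R] (fun x : R => 1 + (x ^+ 2 + a * x)).
  apply: measurable_funD => //; apply: measurable_funD.
    by apply: measurable_funX; exact: measurable_id.
  by apply: measurable_funM => //; exact: measurable_id.
have pos (x : R) : 0 <= 1 + (x ^+ 2 + 1 * x).
  by have := sqr_ge0 (x + 1 / 2); nra.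
have := normal_reflection (m1 1) pos.
have -> : \int[N]_x (1 + ((- x) ^+ 2 + 1 * - x)) =
    \int[N]_x (1 + (x ^+ 2 + (-1) * x)).
  by apply: eq_Rintegral => x _; ring.
by rewrite !E /=; lra.
Qed.

Lemma normal_sin (t : R) : \int[N]_x sin (t * x) = 0.
Proof.
have mt : measurable_fun [set: R] (fun x : R => t * x).
  by apply: measurable_funM => //; exact: measurable_id.
have ms := measurableT_comp measurable_sin mt.
have is_ := integrable_sin N mt.
have i0 : N.-integrable [set: R] (EFin \o cst (1 : R)).
  exact: finite_measure_integrable_cst.
have pos (x : R) : 0 <= 1 + sin (t * x).
  by have := sin_geN1 (t * x); lra.
have := normal_reflection (measurable_funD (measurable_cst (1 : R)) ms) pos.
have -> : \int[N]_x (cst 1 \+ (sin \o [eta *%R t])) (- x) =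
    \int[N]_x (1 - sin (t * x)).
  by apply: eq_Rintegral => x _ /=; rewrite mulrN sinN.
by rewrite RintegralD// RintegralB// Rintegral_cstR; lra.
Qed.

(* With y = sqrt 2 * u - x, the joint density of (x, u) is
   sqrt 2 * pdf x * pdf (sqrt 2 * u - x) = pdf u * normal_pdf (u / sqrt 2) (1 / sqrt 2) x. *)
Lemma normal_stable (H : R -> R) : continuous H -> (forall x, 0 <= H x) ->
  (\int[N]_x \int[N]_y (H (x + y))%:E =
   \int[N]_u (H (Num.sqrt 2 * u))%:E)%E.
Proof.
move=> cH H0; set r : R := Num.sqrt 2.
have r0 : 0 < r by rewrite sqrtr_gt0.
have rr : r ^+ 2 = 2 by rewrite sqr_sqrtr.
have mpdf := @measurable_normal_pdf R 0 1.
have cpdf : continuous pdf by apply: continuous_normal_pdf; rewrite oner_eq0.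
have pdf0 x : 0 <= pdf x by exact: normal_pdf_ge0.
have mH : measurable_fun [set: R] H by exact: continuous_measurable_fun.
have rV : r^-1 = r / 2 by rewrite -rr; field; rewrite gt_eqF.
have mlin (a b : R) : measurable_fun [set: R] (fun u : R => a * u + b).
  by apply: measurable_funD => //; apply: measurable_funM => //; exact: measurable_id.
have inner_ x : (\int[N]_y (H (x + y))%:E =
    \int[lambda]_u (H (r * u) * (pdf (r * u - x) * r))%:E)%E.
  rewrite normal_integral; last 2 first.
  - apply/measurable_EFinP; apply: measurableT_comp mH _.
    by apply: measurable_funD => //; exact: measurable_id.
  - by move=> y; rewrite lee_fin.
  pose F (u : R^o) : R^o := (u - x / r) * r.
  pose G y := H (x + y) * pdf y.
  have F'E : (F^`()%classic = cst r).
    apply/funext => u; rewrite /F derive1E deriveM// deriveB// derive_cst scaler0.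
    by rewrite add0r derive_id derive_cst subr0 scaler1.
  have FE u : F u = r * u - x by rewrite /F mulrBl divfK ?gt_eqF// mulrC.
  transitivity (\int[lambda]_y (G y)%:E)%E.
    by apply: eq_integral => y _; rewrite -EFinM.
  rewrite (@increasing_ge0_integration_by_substitutionT _ F G).
  - apply: eq_integral => u _; congr EFin; rewrite F'E.
    transitivity (G (F u) * r) => //.
    by rewrite FE /G (addrC x) subrK mulrA.
  - by move=> u v uv; rewrite /F ltr_pM2r// ltrD2r.
  - by rewrite F'E => ?; exact: cvg_cst.
  - by rewrite F'E; exact: is_cvg_cst.
  - by rewrite F'E; exact: is_cvg_cst.
  - by move=> u; apply: derivableM => //; apply: derivableB.
  - by apply/gt0_cvgMlNy => //; exact: cvg_addrr_Ny.
  - by apply/gt0_cvgMly => //; exact: cvg_addrr.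
  - move=> y; apply: cvgM; last exact: cpdf.
    apply: (cvg_comp (fun y => x + y) H); last exact: cH.
    by apply: cvgD; [exact: cvg_cst|exact: cvg_id].
  - by move=> y; rewrite mulr_ge0.
(* [Kf0] is the integrand of the inner integral after substitution; [Kf] includes the outer density,
   so that Tonelli can put the integral over x inside. *)
pose Kf (z : R * R) := H (r * z.2) * (pdf (r * z.2 - z.1) * r) * pdf z.1.
pose Kf0 (z : R * R) := H (r * z.2) * (pdf (r * z.2 - z.1) * r).
have mrz : measurable_fun [set: R * R] (fun z => r * z.2).
  by apply: measurable_funM => //; exact: measurable_snd.
have mKf0 : measurable_fun [set: R * R] Kf0.
  apply: measurable_funM; first exact: measurableT_comp mH mrz.
  apply: measurable_funM => //; apply: measurableT_comp mpdf _.
  by apply: measurable_funB => //; exact: measurable_fst.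
have mKf : measurable_fun [set: R * R] Kf.
  apply: measurable_funM => //.
  by apply: measurableT_comp mpdf _; exact: measurable_fst.
have Kf00 z : 0 <= Kf0 z by rewrite !mulr_ge0// ltW.
have Kf_0 z : 0 <= Kf z by rewrite /Kf mulr_ge0//; exact: Kf00.
have mI : measurable_fun [set: R] (fun x => \int[lambda]_u (Kf0 (x, u))%:E)%E.
  apply: (@measurable_fun_fubini_tonelli_F _ _ _ _ _ lambda (EFin \o Kf0)).
  - exact/measurable_EFinP.
  - by move=> z; rewrite lee_fin.
under eq_integral do rewrite inner_.
rewrite [LHS]normal_integral; last 2 first.
- exact: mI.
- by move=> x; apply: integral_ge0 => u _; rewrite lee_fin; exact: (Kf00 (x, u)).
transitivity (\int[lambda]_x \int[lambda]_u (Kf (x, u))%:E)%E.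
  apply: eq_integral => x _; rewrite muleC -ge0_integralZl//.
  - by apply: eq_integral => u _; rewrite -EFinM mulrC.
  - apply/measurable_EFinP.
    exact: (measurable_fun_pair2 x mKf0).
  - by move=> u _; rewrite lee_fin; exact: (Kf00 (x, u)).
  - by rewrite lee_fin.
rewrite (@fubini_tonelli _ _ _ _ _ lambda lambda (EFin \o Kf)); last 2 first.
- exact/measurable_EFinP.
- by move=> z; rewrite lee_fin.
rewrite [RHS]normal_integral; last 2 first.
- by apply/measurable_EFinP; apply: measurableT_comp mH _;
    apply: measurable_funM => //; exact: measurable_id.
- by move=> u; rewrite lee_fin.
apply: eq_integral => u _.
transitivity (\int[lambda]_x ((H (r * u) * pdf u)%:E * (normal_pdf (u / r) r^-1 x)%:E))%E.
  apply: eq_integral => x _; rewrite -EFinM; congr EFin.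
  rewrite /Kf /= -!mulrA; congr (_ * _).
  rewrite !normal01E normal_pdfE ?invr_neq0 ?gt_eqF//.
  rewrite /normal_peak /normal_fun rV.
  have -> : (r / 2) ^+ 2 * pi *+ 2 = pi :> R.
    by rewrite expr_div_n rr; field.
  have -> : (r / 2) ^+ 2 *+ 2 = 1 :> R by rewrite expr_div_n rr; field.
  have -> : Num.sqrt (pi *+ 2) = r * Num.sqrt pi :> R.
    by rewrite -mulr_natl sqrtrM.
  set q := Num.sqrt pi; have q0 : 0 < q by rewrite sqrtr_gt0 pi_gt0.
  have EE : expR (- (r * u - x) ^+ 2 / 2) * expR (- x ^+ 2 / 2) =
      expR (- u ^+ 2 / 2) * expR (- (x - u * (r / 2)) ^+ 2 / 1).
    rewrite -!expRD; congr expR.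
    have -> : (x - u * (r / 2)) ^+ 2 = x ^+ 2 - r * u * x + u ^+ 2 * (r ^+ 2) / 4 by field.
    have -> : (r * u - x) ^+ 2 = r ^+ 2 * u ^+ 2 - 2 * r * u * x + x ^+ 2 by ring.
    by rewrite rr; field.
  transitivity ((r * q)^-1 * q^-1 *
      (expR (- (r * u - x) ^+ 2 / 2) * expR (- x ^+ 2 / 2))).
    by field; rewrite !gt_eqF.
  by rewrite EE; field; rewrite !gt_eqF.
rewrite ge0_integralZl//.
- by rewrite integral_normal_pdf mule1 EFinM.
- by apply/measurable_EFinP; exact: measurable_normal_pdf.
- by move=> x _; rewrite lee_fin normal_pdf_ge0.
- by rewrite lee_fin mulr_ge0.
Qed.

Let cf (t : R) := \int[N]_x cos (t * x).

Let measurable_scale (t : R) : measurable_fun [set: R] (fun x : R => t * x).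
Proof. by apply: measurable_funM => //; exact: measurable_id. Qed.

(** For independent normal x and y, x + y has the law of sqrt 2 times a normal variable, and the
    mean of cos (t (x + y)) is a product of cosine means because the sine integrals vanish. *)
Let cf_sqrt2 t : cf (t * Num.sqrt 2) = cf t ^+ 2.
Proof.
(* [normal_stable] is about nonnegative functions, hence the shift of [cos] by 1. *)
pose H z := 1 + cos (t * z).
have cH : continuous H.
  move=> z; apply: cvgD; first exact: cvg_cst.
  apply: (cvg_comp (fun y => t * y) cos); last exact: continuous_cos.
  by apply: cvgM; [exact: cvg_cst|exact: cvg_id].
have H0 z : 0 <= H z by have := cos_geN1 (t * z); rewrite /H; lra.
have i1 : N.-integrable [set: R] (EFin \o cst (1 : R)).
  exact: finite_measure_integrable_cst.
have ic a := integrable_cos N (measurable_scale a).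
have is_ := integrable_sin N (measurable_scale t).
have E1 a : (\int[N]_u (1 + cos (a * u))%:E = (1 + cf a)%:E)%E.
  rewrite (EFin_Rintegral (integrable_addR i1 (ic a))).
  by rewrite RintegralD// Rintegral_cstR.
have E2 x : (\int[N]_y (H (x + y))%:E = (1 + cos (t * x) * cf t)%:E)%E.
  transitivity (\int[N]_y (1 + (cos (t * x) * cos (t * y) -
                              sin (t * x) * sin (t * y)))%:E)%E.
    by apply: eq_integral => y _; rewrite /H mulrDr cosD.
  have i2 : N.-integrable [set: R] (EFin \o (fun y => cos (t * x) * cos (t * y))).
    exact: (integrable_scaleR _ (ic t)).
  have i3 : N.-integrable [set: R] (EFin \o (fun y => sin (t * x) * sin (t * y))).
    exact: (integrable_scaleR _ is_).
  rewrite (EFin_Rintegral (integrable_addR i1 (integrable_subR i2 i3))).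
  rewrite RintegralD//; last exact: (integrable_subR i2 i3).
  rewrite RintegralB// !RintegralZl// Rintegral_cstR.
  by rewrite (normal_sin t) mulr0 subr0.
have := normal_stable cH H0.
under eq_integral do rewrite E2.
under [X in _ = X -> _]eq_integral do rewrite /H mulrA.
rewrite E1.
have i4 : N.-integrable [set: R] (EFin \o (fun x => cos (t * x) * cf t)).
  by under eq_fun do rewrite mulrC; exact: (integrable_scaleR _ (ic t)).
rewrite (EFin_Rintegral (integrable_addR i1 i4)).
rewrite RintegralD// RintegralZr// Rintegral_cstR => -[].
by rewrite -/(cf t) expr2; lra.
Qed.

(* For normal summands the sequence of the central limit theorem is constant along
   n = 2^k, so it equals its limit. *)
Lemma normal_characteristic (t : R) :
  cf t = expR (- (t ^+ 2 * inner N idfun idfun / 2)).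
Proof.
have tC : L2_centered N (fun x => t * x).
  have [iL i0] := normal_centered; split; first exact: (L2Z t iL).
  by rewrite (innerZl t iL (L2_cst N 1)) i0 mulr0.
have [+ _] := rotation_clt tC.
have -> : inner N (fun x => t * x) (fun x => t * x) = t ^+ 2 * inner N idfun idfun.
  have [iL _] := normal_centered.
  by rewrite (innerZl t iL (L2Z t iL)) (innerZr t iL iL) mulrA expr2.
set c := expR _; pose q (n : nat) : R := cf (t / Num.sqrt n%:R).
have rot C n : (rotation C 0 n).1 = C ^+ n /\ (rotation C 0 n).2 = 0 :> R.
  elim: n => [|n] /=; first by rewrite expr0.
  case: rotation => x y /= [-> ->]; rewrite exprSr; split; ring.
under eq_fun => n.
  rewrite (_ : (\int[N]_x cos (t * x / Num.sqrt n%:R)) = q n); last first.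
    by apply: eq_Rintegral => x _; rewrite mulrAC.
  rewrite (_ : (\int[N]_x sin (t * x / Num.sqrt n%:R)) = 0); last first.
    rewrite -[RHS](normal_sin (t / Num.sqrt n%:R)).
    by apply: eq_Rintegral => x _; rewrite mulrAC.
  rewrite (rot _ _).1.
over.
move=> qc.
have qk k : q (2 ^ k)%N ^+ (2 ^ k) = cf t.
  elim: k => [|k ih]; first by rewrite /q sqrtr1 divr1 expr1.
  rewrite -ih expnS exprM; congr (_ ^+ _).
  rewrite /q -cf_sqrt2; congr cf; rewrite natrM sqrtrM// invfM.
  by rewrite -mulrA mulrAC mulVf ?mul1r// gt_eqF// sqrtr_gt0.
have pow2 : (fun k => 2 ^ k)%N @ \oo --> \oo.
  by apply/cvgnyPge => A; exists A => // k /= Ak; exact: leq_trans Ak (ltnW (ltn_expl _ _)).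
have := cvg_comp _ _ pow2 qc.
have -> : (fun n => q n ^+ n) \o (fun k => (2 ^ k)%N) = cst (cf t).
  by apply/funext => k /=; rewrite qk.
by move=> H; apply: (@cvg_unique _ _ (cst (cf t) @ \oo)) => //; exact: cvg_cst.
Qed.

(** Variance 0 would concentrate the law on {0}, a null set. Positivity suffices for
    [standard_normal_exists], which rescales by the root of the variance without knowing its
    value. *)
Lemma normal_variance_gt0 : 0 < inner N idfun idfun.
Proof.
have [iL _] := normal_centered.
rewrite lt_neqAle inner_ge0 andbT; apply/eqP => /esym /(inner_eq0 iL) [A [mA A0 sA]].
have N0 : N [set 0] = 0%E.
  rewrite /N /= /normal_prob integral_set1//.
have : N setT = 1%E by exact: probability_setT.
have -> : [set: measurableTypeR R] = A `|` [set 0].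
  apply/seteqP; split=> // x _; have [->|x0] := eqVneq x 0; first by right.
  by left; apply: sA => /= /(_ I) /eqP; rewrite (negbTE x0).
move=> N1; suff : (1%E <= 0 :> \bar R)%E by rewrite lee_fin ler10.
apply: (@le_trans _ _ (N A + N [set 0%R])%E); last by rewrite A0 N0 adde0.
by rewrite -N1; exact: measureU2.
Qed.

End gaussian_law.

Lemma standard_normal_exists (R : realType) :
  exists (N : probability (measurableTypeR R) R) (z : R -> R),
    L2 N z /\ forall t : R,
      \int[N]_x cos (t * z x) = expR (- (t ^+ 2 / 2)) /\
      \int[N]_x sin (t * z x) = 0.
Proof.
have v0 := @normal_variance_gt0 R; set v := inner _ _ _ in v0.
exists (normal_prob 0 1), (fun x => (Num.sqrt v)^-1 * x); split.
  by have [iL _] := @normal_centered R; exact: (L2Z _ iL).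
move=> t; split.
  under eq_Rintegral do rewrite mulrA.
  rewrite normal_characteristic -/v; congr expR.
  rewrite exprMn exprVn sqr_sqrtr ?ltW//; field; rewrite gt_eqF//.
by under eq_Rintegral do rewrite mulrA; exact: normal_sin.
Qed.

Section sums_of_squares.
Context {R : realType} (m : nat).
Implicit Types (A : 'I_m -> 'I_m -> R) (t : 'I_m -> R).

Let form A t := \sum_i t i * \sum_j A i j * t j.
Let symmetric A := forall i j, A i j = A j i.

(** Along the axis k the form is a polynomial of degree at most 2 in c, and both cases of the
    reduction are read from its coefficients. *)
Let formD A t (c : R) k : symmetric A ->
  form A (fun j => t j + c * (j == k)%:R) =
  form A t + 2 * c * (\sum_j A k j * t j) + c ^+ 2 * A k k.
Proof.
move=> sA; set L := fun i => \sum_j A i j * t j.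
have delta (F : 'I_m -> R) : \sum_j F j * (j == k)%:R = F k.
  rewrite (bigD1 k)//= eqxx mulr1 big1 ?addr0// => j /negbTE ->.
  by rewrite mulr0.
transitivity (\sum_i (t i * L i + c * (A k i * t i) + c * ((L i + c * A i k) * (i == k)%:R))).
  apply: eq_bigr => i _; have -> : \sum_j A i j * (t j + c * (j == k)%:R) = L i + c * A i k.
    under eq_bigr do rewrite mulrDr mulrCA.
    by rewrite big_split/= -mulr_sumr delta.
  by rewrite (sA k i); ring.
rewrite !big_split/= -!mulr_sumr delta -/(form A t) -/(L k); ring.
Qed.

(* Lagrange's reduction: completing the square in a variable with [A k k != 0]
   leaves a positive form that no longer involves that variable. *)
Lemma psd_sum_of_squares A : symmetric A -> (forall t, 0 <= form A t) ->
  exists s : seq ('I_m -> R), forall t,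
    \sum_i t i * (\sum_j A i j * t j) = \sum_(a <- s) (\sum_i t i * a i) ^+ 2.
Proof.
have [n] := ubnP #|[pred i | A i i != 0]|; elim: n A => // n ih A.
rewrite ltnS => cA sA pA.
have [k Ak|A0] := pickP (fun i => A i i != 0); last first.
  have Az k t : \sum_j A k j * t j = 0.
    set l := \sum_j _; have [//|l0] := eqVneq l 0.
    (* With [A k k = 0] the form is affine in c along the axis k; this c would bring it to -1. *)
    have := pA (fun j => t j + (- (form A t + 1) / (2 * l)) * (j == k)%:R).
    rewrite formD// -/l (eqP (negbFE (A0 k))) mulr0 addr0.
    have -> : 2 * (- (form A t + 1) / (2 * l)) * l = - (form A t + 1) by field.
    lra.
  exists [::] => t; rewrite big_nil big1// => i _.
  by rewrite Az mulr0.
have Ak0 : 0 < A k k.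
  rewrite lt_neqAle eq_sym Ak/=.
  have := pA (fun j => 0 + 1 * (j == k)%:R).
  rewrite formD// expr1n !mul1r mulr1.
  have -> : form A (fun=> 0) = 0 by rewrite /form big1// => i _; rewrite mul0r.
  by rewrite big1 ?mulr0 ?add0r// => j _; rewrite mulr0.
pose A' i j := A i j - A k i * A k j / A k k.
have formA' t : form A' t = form A t - (\sum_i A k i * t i) ^+ 2 / A k k.
  rewrite /form; set l := \sum_i A k i * t i.
  have -> : l ^+ 2 / A k k = \sum_i t i * (A k i * l / A k k).
    rewrite expr2 {1}/l !mulr_suml; apply: eq_bigr => i _; ring.
  rewrite -sumrB; apply: eq_bigr => i _; rewrite -mulrBr; congr (_ * _).
  have -> : A k i * l / A k k = \sum_j A k i * A k j / A k k * t j.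
    rewrite /l mulr_sumr mulr_suml; apply: eq_bigr => j _; ring.
  by rewrite -sumrB; apply: eq_bigr => j _; rewrite mulrBl.
have pA' t : 0 <= form A' t.
  rewrite formA'; set l := \sum_i _.
  (* This c minimizes the form of [A] along the axis k, and the minimum is the value of the form of
     [A']. *)
  have := pA (fun j => t j + (- l / A k k) * (j == k)%:R).
  rewrite formD// -/l; congr (_ <= _); field; exact: Ak.
have sA' : symmetric A'.
  by move=> i j; rewrite /A' (sA i j) (mulrC (A k i)).
have [|s sE] := ih A' _ sA' pA'.
  (* The number of nonzero diagonal entries drops: the entry at k becomes 0, and an entry that was 0
     stays 0, being then both nonnegative and nonpositive in [A']. *)
  apply: leq_trans _ cA; apply: proper_card; apply/properP; split.
    apply/fintype.subsetP => i; rewrite !inE; apply: contra => /eqP Ai.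
    have : 0 <= A' i i.
      have := pA' (fun j => 0 + 1 * (j == i)%:R).
      rewrite formD// expr1n !mul1r mulr1.
      have -> : form A' (fun=> 0) = 0 by rewrite /form big1// => j _; rewrite mul0r.
      by rewrite big1 ?mulr0 ?add0r// => j _; rewrite mulr0.
    rewrite /A' Ai sub0r oppr_ge0 => h; have : 0 <= A k i * A k i / A k k.
      by rewrite mulr_ge0 ?invr_ge0 ?(ltW Ak0)// -expr2 sqr_ge0.
    by move=> h'; rewrite oppr_eq0 eq_le h h'.
  exists k; rewrite !inE ?Ak// negbK /A'; apply/eqP; field; exact: Ak.
exists ((fun i => A k i / Num.sqrt (A k k)) :: s) => t.
rewrite big_cons -sE -[X in _ + X]/(form A' t) formA' -/(form A t).
have -> : (\sum_i t i * (A k i / Num.sqrt (A k k))) ^+ 2 =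
    (\sum_i A k i * t i) ^+ 2 / A k k.
  rewrite -[in RHS](sqr_sqrtr (ltW Ak0)) -expr_div_n; congr (_ ^+ 2).
  by rewrite mulr_suml; apply: eq_bigr => i _; ring.
by rewrite addrC subrK.
Qed.

End sums_of_squares.

Section product_spaces.
Context {R : realType} d d' (T : measurableType d) (T' : measurableType d').
Variables (P : probability T R) (P' : probability T' R).

Lemma integrable_fst (f : T -> R) : P.-integrable [set: T] (EFin \o f) ->
  (P \x P')%E.-integrable [set: T * T'] (EFin \o (fun z => f z.1)).
Proof.
move=> fi; have mf := integrable_measurable fi.
have mf1 : measurable_fun [set: T * T'] (fun z => f z.1).
  exact: measurableT_comp mf measurable_fst.
apply/integrableP; split; first exact/measurable_EFinP.
rewrite fubini_tonelli1//=; last by apply/measurable_EFinP; exact: measurableT_comp.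
have /integrableP[_] := fi; congr (_ < _)%E; apply: eq_integral => x _.
by rewrite /fubini_F /= integral_cst// [X in (_ * X)%E](_ : _ = 1%E) ?mule1//;
  exact: probability_setT.
Qed.

Lemma integrable_snd (f : T' -> R) : P'.-integrable [set: T'] (EFin \o f) ->
  (P \x P')%E.-integrable [set: T * T'] (EFin \o (fun z => f z.2)).
Proof.
move=> fi; have mf := integrable_measurable fi.
have mf1 : measurable_fun [set: T * T'] (fun z => f z.2).
  exact: measurableT_comp mf measurable_snd.
apply/integrableP; split; first exact/measurable_EFinP.
rewrite fubini_tonelli1//=; last by apply/measurable_EFinP; exact: measurableT_comp.
have /integrableP[_] := fi; apply: le_lt_trans.
rewrite /fubini_F /= integral_cst// [X in (_ * X)%E](_ : _ = 1%E) ?mule1//.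
exact: probability_setT.
Qed.

Lemma Rintegral_prod (u : T -> R) (v : T' -> R) :
  measurable_fun [set: T] u -> measurable_fun [set: T'] v ->
  (forall x, `|u x| <= 1) -> (forall y, `|v y| <= 1) ->
  \int[(P \x P')%E]_z (u z.1 * v z.2) = \int[P]_x u x * \int[P']_y v y.
Proof.
move=> mu mv u1 v1; have ui := integrable_boundedR P mu u1.
have vi := integrable_boundedR P' mv v1.
rewrite {1}/Rintegral -integral12_prod_meas1; last first.
  apply: (@integrable_boundedR _ _ _ _ _ 1).
    apply: measurable_funM; first exact: measurableT_comp mu measurable_fst.
    exact: measurableT_comp mv measurable_snd.
  by move=> z; rewrite normrM mulr_ile1.
rewrite -RintegralZr// /Rintegral; congr fine; apply: eq_integral => x _.
rewrite /fubini_F /=.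
by rewrite (EFin_Rintegral (integrable_scaleR (u x) vi)) RintegralZl.
Qed.

End product_spaces.

(** Each square brings an independent standard normal variable z, living on a new factor of a
    product space: adding z a to the vector multiplies the characteristic function by exp (- (t .
    a)^2 / 2). *)
Lemma gaussian_vector_exists (R : realType) (m : nat) (s : seq ('I_m -> R)) :
  exists d (T : measurableType d) (P : probability T R) (W : 'I_m -> T -> R),
  [/\ forall i, measurable_fun [set: T] (W i),
      forall i, P.-integrable [set: T] (EFin \o (fun w => W i w ^+ 2))
    & forall t : 'I_m -> R,
      \int[P]_w cos (\sum_i t i * W i w) =
        expR (- ((\sum_(a <- s) (\sum_i t i * a i) ^+ 2) / 2)) /\
      \int[P]_w sin (\sum_i t i * W i w) = 0].
Proof.
have [N [z [zL zN]]] := standard_normal_exists R.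
elim: s => [|a s [d [T [P [W [mW iW cfW]]]]]].
  exists _, _, N, (fun _ => cst 0); split=> [//|i|t].
    apply: (@integrable_boundedR _ _ _ _ _ 0) => [|x]; first exact: measurable_funX.
    by rewrite expr0n normr0.
  have E0 (x : R) : \sum_(i < m) t i * cst 0 x = 0.
    by rewrite big1// => i _; rewrite mulr0.
  rewrite big_nil mul0r oppr0 expR0; split.
    by under eq_Rintegral do rewrite E0 cos0; exact: Rintegral_cstR.
  by under eq_Rintegral do rewrite E0 sin0; exact: Rintegral_cstR.
have mz := L2_measurable zL.
have [_ iz] := (L2P N z).1 zL.
exists _, _, (P \x N)%E, (fun i x => W i x.1 + a i * z x.2).
have mW1 i : measurable_fun [set: T * measurableTypeR R] (fun x => W i x.1).
  exact: measurableT_comp (mW i) measurable_fst.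
have mz2 : measurable_fun [set: T * measurableTypeR R] (fun x => z x.2).
  by apply: measurableT_comp mz _; exact: measurable_snd.
have mW' i : measurable_fun [set: T * measurableTypeR R] (fun x => W i x.1 + a i * z x.2).
  by apply: measurable_funD => //; exact: measurable_funM.
split=> [//|i|t].
  have ig := integrable_addR (integrable_scaleR 2 (integrable_fst N (iW i)))
    (integrable_scaleR (2 * a i ^+ 2) (integrable_snd P iz)).
  refine (@integrable_dominatedR _ _ _ (P \x N)%E _ _ _ ig _).
    exact: measurable_funX.
  move=> x; rewrite ger0_norm ?sqr_ge0//.
  by have := sqr_ge0 (W i x.1 - a i * z x.2); nra.
set tau := \sum_i t i * a i.
have E x : \sum_i t i * (W i x.1 + a i * z x.2) = \sum_i t i * W i x.1 + tau * z x.2.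
  by rewrite /tau mulr_suml -big_split; apply: eq_bigr => i _ /=; ring.
have mS : measurable_fun [set: T] (fun w => \sum_i t i * W i w).
  by apply: measurable_sum => i; apply: measurable_funM.
have mtz : measurable_fun [set: measurableTypeR R] (fun x => tau * z x).
  by apply: measurable_funM.
have mc1 := measurableT_comp measurable_cos mS.
have ms1 := measurableT_comp measurable_sin mS.
have mc2 := measurableT_comp measurable_cos mtz.
have ms2 := measurableT_comp measurable_sin mtz.
have c1 (x : R) : `|cos x| <= 1 by rewrite ler_norml cos_geN1 cos_le1.
have s1 (x : R) : `|sin x| <= 1 by rewrite ler_norml sin_geN1 sin_le1.
have I (u : T -> R) (v : measurableTypeR R -> R) :
    measurable_fun [set: T] u -> measurable_fun [set: measurableTypeR R] v ->
    (forall x, `|u x| <= 1) -> (forall y, `|v y| <= 1) ->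
    (P \x N)%E.-integrable [set: T * measurableTypeR R] (EFin \o (fun x => u x.1 * v x.2)).
  move=> mu mv u1 v1; apply: (@integrable_boundedR _ _ _ _ _ 1).
    apply: measurable_funM; first exact: measurableT_comp mu measurable_fst.
    exact: measurableT_comp mv measurable_snd.
  by move=> x; rewrite normrM mulr_ile1.
have [cW sW] := cfW t; have [cN sN] := zN tau.
pose S w := \sum_i t i * W i w.
have pr (u v : R -> R) : measurable_fun [set: T] (u \o S) ->
    measurable_fun [set: measurableTypeR R] (v \o (fun x => tau * z x)) ->
    (forall x, `|u x| <= 1) -> (forall y, `|v y| <= 1) ->
    \int[(P \x N)%E]_x (u (S x.1) * v (tau * z x.2)) =
    \int[P]_w u (S w) * \int[N]_x v (tau * z x).
  by move=> mu mv u1 v1; exact: (Rintegral_prod P N mu mv (fun x => u1 _) (fun y => v1 _)).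
rewrite big_cons -/tau; split.
- under eq_Rintegral do rewrite E cosD.
  rewrite (RintegralB _ (I _ _ mc1 mc2 (fun=> c1 _) (fun=> c1 _)) (I _ _ ms1 ms2 (fun=> s1 _) (fun=> s1 _)))//.
  rewrite (pr cos cos mc1 mc2 c1 c1) (pr sin sin ms1 ms2 s1 s1).
  rewrite cW sW cN mul0r subr0 -expRD; congr expR; ring.
- under eq_Rintegral do rewrite E sinD.
  rewrite (RintegralD _ (I _ _ ms1 mc2 (fun=> s1 _) (fun=> c1 _)) (I _ _ mc1 ms2 (fun=> c1 _) (fun=> s1 _)))//.
  rewrite (pr sin cos ms1 mc2 s1 c1) (pr cos sin mc1 ms2 c1 s1).
  by rewrite sW sN mul0r mulr0 addr0.
Qed.

(** * Approximation by trigonometric polynomials *)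

Section bernstein_operators.
Context {R : realType}.
Implicit Types (s : R) (g h : nat -> R).

(* The expectation of [g] under the binomial law with parameters [n] and [s]. *)
Fixpoint bernstein s n g : R :=
  if n is n'.+1 then
    s * bernstein s n' (fun k => g k.+1) + (1 - s) * bernstein s n' g
  else g 0.

Lemma bernstein_lin s n a g h :
  bernstein s n (fun k => a * g k + h k) = a * bernstein s n g + bernstein s n h.
Proof. by elim: n g h => //= n ih g h; rewrite !ih; ring. Qed.

Lemma bernstein_cst s n c : bernstein s n (fun=> c) = c.
Proof. by elim: n => //= n ->; ring. Qed.

Lemma le_bernstein s n g h : 0 <= s <= 1 -> (forall k, (k <= n)%N -> g k <= h k) ->
  bernstein s n g <= bernstein s n h.
Proof.
move=> /andP[s0 s1]; elim: n g h => [|n ih] g h gh /=; first exact: gh.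
apply: lerD; apply: ler_wpM2l; rewrite ?subr_ge0//; apply: ih => k kn; apply: gh => //.
exact: leqW.
Qed.

(** Variance plus squared bias of the binomial law, the input of the Chebyshev argument in
    [trig_approximation]. *)
Lemma bernstein_sqr s n c :
  bernstein s n (fun k => (k%:R - c) ^+ 2) =
  n%:R * (s * (1 - s)) + (n%:R * s - c) ^+ 2.
Proof.
elim: n c => [|n ih] c /=; first by ring.
have -> : bernstein s n (fun k => (k.+1%:R - c) ^+ 2) =
    bernstein s n (fun k => (k%:R - (c - 1)) ^+ 2).
  by congr bernstein; apply/funext => k; rewrite -natr1; ring.
by rewrite !ih -natr1; ring.
Qed.

Variable m : nat.
Implicit Types (x : 'I_m -> R) (l : seq 'I_m) (F G : ('I_m -> nat) -> R).

(* [l] lists the coordinates still to be averaged, and [kappa] records the values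
   of the others. *)
Fixpoint mbernstein x n l F (kappa : 'I_m -> nat) : R :=
  if l is i :: l' then
    bernstein (x i) n (fun k =>
      mbernstein x n l' F (fun j => if j == i then k else kappa j))
  else F kappa.

Lemma mbernstein_lin x n l a F G kappa :
  mbernstein x n l (fun k => a * F k + G k) kappa =
  a * mbernstein x n l F kappa + mbernstein x n l G kappa.
Proof.
elim: l kappa => //= i l ih kappa; rewrite -bernstein_lin.
by congr bernstein; apply/funext => k; rewrite ih.
Qed.

Lemma mbernstein_cst x n l c kappa : mbernstein x n l (fun=> c) kappa = c.
Proof.
elim: l kappa => //= i l ih kappa.
by rewrite -[RHS](bernstein_cst (x i) n); congr bernstein; apply/funext => k; exact: ih.
Qed.

Lemma le_mbernstein x n l F G kappa : (forall i, 0 <= x i <= 1) ->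
  (forall i, (kappa i <= n)%N) ->
  (forall k, (forall i, (k i <= n)%N) -> F k <= G k) ->
  mbernstein x n l F kappa <= mbernstein x n l G kappa.
Proof.
move=> x01 + FG; elim: l kappa => [|i l ih] kappa kn /=; first exact: FG.
apply: le_bernstein => // k kn'; apply: ih => j.
by case: ifP.
Qed.

Lemma mbernstein_coord x n l i g kappa :
  mbernstein x n l (fun k => g (k i)) kappa =
  if i \in l then bernstein (x i) n g else g (kappa i).
Proof.
elim: l kappa => //= j l ih kappa; rewrite inE.
under [X in bernstein _ _ X]eq_fun do rewrite ih.
case: (boolP (i \in l)) => il; first by rewrite orbT bernstein_cst.
rewrite orbF; case: eqP => [->//|_]; exact: bernstein_cst.
Qed.

Lemma mbernstein_sum x n l (I : Type) (r : seq I) (F : I -> ('I_m -> nat) -> R) kappa :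
  mbernstein x n l (fun k => \sum_(i <- r) F i k) kappa =
  \sum_(i <- r) mbernstein x n l (F i) kappa.
Proof.
elim: r => [|i r ih].
  by under [X in mbernstein _ _ _ X]eq_fun do rewrite big_nil; rewrite big_nil mbernstein_cst.
rewrite big_cons -ih -[X in X + _]mul1r -mbernstein_lin.
by under [X in mbernstein _ _ _ X]eq_fun do rewrite big_cons -[X in X + _]mul1r.
Qed.

Lemma mbernstein_sqr_le x n kappa i : (0 < n)%N -> 0 <= x i <= 1 ->
  mbernstein x n (enum 'I_m) (fun k => ((k i)%:R / n%:R - x i) ^+ 2) kappa <= n%:R^-1.
Proof.
move=> n0 /andP[x0 x1].
rewrite (mbernstein_coord x n _ i (fun k => (k%:R / n%:R - x i) ^+ 2)) mem_enum inE.
have nR : n%:R != 0 :> R by rewrite pnatr_eq0 -lt0n.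
have -> : (fun k : nat => (k%:R / n%:R - x i) ^+ 2) =
    (fun k : nat => (n%:R ^+ 2)^-1 * (k%:R - n%:R * x i) ^+ 2 + 0).
  by apply/funext => k; field.
rewrite bernstein_lin bernstein_cst bernstein_sqr subrr expr0n !addr0.
have -> : (n%:R ^+ 2)^-1 * (n%:R * (x i * (1 - x i))) = n%:R^-1 * (x i * (1 - x i)).
  by field.
by rewrite ler_piMr ?invr_ge0//; nra.
Qed.

End bernstein_operators.

Section trigonometric_polynomials.
Context {R : realType} (m : nat).
Implicit Types f g : 'rV[R]_m -> R.

(** Each triple holds an amplitude, a frequency vector and a phase. Phases make sines instances of
    cosines, and the product-to-sum formula keeps the class closed under products. *)
Definition trig_poly f := exists s : seq (R * ('I_m -> R) * R), forall x,
  f x = \sum_(q <- s) q.1.1 * cos (\sum_i q.1.2 i * x 0 i + q.2).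

Lemma trig_poly_cst c : trig_poly (cst c).
Proof.
exists [:: (c, fun=> 0, 0)] => x; rewrite big_seq1 /= addr0.
by rewrite big1 ?cos0 ?mulr1// => i _; rewrite mul0r.
Qed.

Lemma trig_polyD f g : trig_poly f -> trig_poly g -> trig_poly (fun x => f x + g x).
Proof.
by move=> [s sE] [s' s'E]; exists (s ++ s') => x; rewrite sE s'E big_cat.
Qed.

Lemma trig_polyM f g : trig_poly f -> trig_poly g -> trig_poly (fun x => f x * g x).
Proof.
move=> [s sE] [s' s'E].
pose p (q q' : R * ('I_m -> R) * R) :=
  (q.1.1 * q'.1.1 / 2, fun i => q.1.2 i + q'.1.2 i, q.2 + q'.2).
pose d (q q' : R * ('I_m -> R) * R) :=
  (q.1.1 * q'.1.1 / 2, fun i => q.1.2 i - q'.1.2 i, q.2 - q'.2).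
exists ([seq p q q' | q <- s, q' <- s'] ++ [seq d q q' | q <- s, q' <- s']) => x.
rewrite big_cat !big_allpairs_dep/= sE s'E mulr_suml -big_split/=.
apply: eq_bigr => q _; rewrite mulr_sumr -big_split/=; apply: eq_bigr => q' _.
set u := \sum_i _ + _; set v := \sum_i _ + q'.2.
have -> : \sum_i (q.1.2 i + q'.1.2 i) * x 0 i + (q.2 + q'.2) = u + v.
  by under eq_bigr do rewrite mulrDl; rewrite big_split/= /u /v addrACA.
have -> : \sum_i (q.1.2 i - q'.1.2 i) * x 0 i + (q.2 - q'.2) = u - v.
  by under eq_bigr do rewrite mulrBl; rewrite sumrB /u /v opprD addrACA.
by rewrite (cosD u v) (cosB u v); field.
Qed.

Lemma trig_poly_sin (t : R) i : trig_poly (fun x => sin (t * x 0 i)).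
Proof.
exists [:: (1, fun j => t * (j == i)%:R, - (pi / 2))] => x.
rewrite big_seq1 /= mul1r cosBpihalf; congr sin.
rewrite (bigD1 i)//= eqxx mulr1 big1 ?addr0// => j /negbTE ->.
by rewrite mulr0 mul0r.
Qed.

Lemma trig_poly_bernstein (s : 'rV[R]_m -> R) n (g : 'rV[R]_m -> nat -> R) :
  trig_poly s -> (forall k, trig_poly (g ^~ k)) ->
  trig_poly (fun x => bernstein (s x) n (g x)).
Proof.
move=> ts; elim: n g => [|n ih] g tg /=; first exact: tg.
apply: trig_polyD; apply: trig_polyM => //.
- by apply: (ih (fun x k => g x k.+1)) => k; exact: tg.
- apply: trig_polyD; first exact: trig_poly_cst.
  have := trig_polyM (trig_poly_cst (-1)) ts.
  by under eq_fun do rewrite mulN1r.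
- exact: ih.
Qed.

Lemma trig_poly_mbernstein (s : 'rV[R]_m -> 'I_m -> R) n l F kappa :
  (forall i, trig_poly (s ^~ i)) ->
  trig_poly (fun x => mbernstein (s x) n l F kappa).
Proof.
move=> ts; elim: l kappa => [|i l ih] kappa /=; first exact: trig_poly_cst.
apply: (@trig_poly_bernstein (s ^~ i) n (fun x k => mbernstein (s x) n l F
  (fun j => if j == i then k else kappa j))) => // k; exact: ih.
Qed.

End trigonometric_polynomials.

Section trigonometric_approximation.
Context {R : realType} (m : nat).
Implicit Types f : 'rV[R]_m -> R.

(** Only [x] is confined to the box, so compactness is applied to [P], a property of [x] that
    already quantifies over all [y]. *)
Lemma uniform_continuity_box f (a e : R) : continuous f -> 0 < e ->
  exists2 d : R, 0 < d & forall x y : 'rV[R]_m, (forall i, `|x 0 i| <= a) ->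
    (forall i, `|x 0 i - y 0 i| < d) -> `|f x - f y| < e.
Proof.
move=> cf e0.
pose K := [set x : 'rV[R]_m | forall i : 'I_m, `[- a, a]%classic (x ord0 i)].
have cK : compact K.
  exact: (@rV_compact R m (fun=> `[- a, a]%classic) (fun=> @segment_compact R (- a) a)).
pose P (d : R) (x : 'rV[R]_m) := forall y : 'rV[R]_m,
  (forall i, `|x 0 i - y 0 i| < d) -> `|f x - f y| < e.
have cov x : K x -> \forall x' \near x & d \near 0^'+, P d x'.
  move=> _; have e20 : 0 < e / 2 by rewrite divr_gt0.
  have /cvgrPdist_lt/(_ _ e20)/nbhs_ballP [r /= r0 fr] := cf x.
  have r20 : 0 < r / 2 by rewrite divr_gt0.
  exists (ball x (r / 2), [set d | d < r / 2]) => /=.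
    by split; [exact: nbhsx_ballx|exact: nbhs_right_lt].
  move=> [x' d] /= [[_ xx'] dr] y x'y.
  have fx' : `|f x - f x'| < e / 2.
    apply: fr; split=> // i j; apply: le_ball (xx' i j).
    by rewrite ler_pdivrMr//; lra.
  have fy : `|f x - f y| < e / 2.
    apply: fr; split=> // i j; rewrite (ord1 i).
    have := xx' 0 j; rewrite /ball/= => h1.
    have := x'y j => h2; rewrite -(subrKA (x' 0 j)).
    by apply: le_lt_trans (ler_normD _ _) _; lra.
  rewrite -(subrKA (f x)); apply: le_lt_trans (ler_normD _ _) _.
  by rewrite distrC; lra.
have /compact_near_coveringP/(_ R (0^'+) P _ cov) Kd := cK.
have [d [Pd d0]] : exists d, (K `<=` P d) /\ 0 < d.
  apply: (@filter_ex _ (0^'+ : set_system R)).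
  by apply: filterI => //; exact: nbhs_right_gt.
exists d => // x y xa xy; apply: Pd => // i /=.
by rewrite in_itv/= -ler_norml.
Qed.

(* The clamping makes this inverse of sin on [-1, 1] Lipschitz. *)
Let clamp_asin (z : R) := asin (Num.min (sin 1) (Num.max (- sin 1) z)).

Let pi2_ge1 : 1 <= pi / 2 :> R.
Proof. by rewrite ler_pdivlMr// mul1r pi_ge2. Qed.

Let sin1_ge0 : 0 <= sin 1 :> R.
Proof.
by rewrite -[X in X <= _]sin0 leNgt ltr_sin ?in_itv/= -?leNgt//; have := pi2_ge1; lra.
Qed.

(* On [-1, 1] the derivative of sin is at least cos 1. *)
Let sin_lipschitz_inv (u v : R) : - 1 <= u <= 1 -> - 1 <= v <= 1 ->
  cos 1 * `|u - v| <= `|sin u - sin v|.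
Proof.
wlog uv : u v / v <= u.
  move=> H; have [/H//|/ltW/H {}H hu hv] := leP v u.
  by rewrite distrC (distrC (sin u)); exact: H.
move=> /andP[u1 u2] /andP[v1 v2].
have [c] := MVT_segment uv (fun x _ => is_derive_sin x)
  (is_derive_within_continuous (@is_derive_sin R)).
rewrite in_itv/= => /andP[vc cu] ->; rewrite normrM ler_wpM2r//.
apply: le_trans (ler_norm _).
have cos_abs : cos c = cos `|c|.
  by have [c0|c0] := ler0P c; rewrite ?cosN// ger0_norm.
rewrite cos_abs leNgt ltr_cos ?in_itv/=.
- by rewrite -leNgt ler_norml; lra.
- by rewrite ler01/=; have := @pi_ge2 R; lra.
- by rewrite normr_ge0/= ler_norml; have := @pi_ge2 R; lra.
Qed.

(** Clamping is the projection onto [- sin 1, sin 1], which contains sin u, so it does not increase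
    the distance to sin u; [sin_lipschitz_inv] then applies. *)
Let clamp_asin_lipschitz (z u : R) : - 1 <= u <= 1 ->
  cos 1 * `|clamp_asin z - u| <= `|z - sin u|.
Proof.
move=> u1; have /andP[u1l u1r] := u1.
set w := Num.min (sin 1) (Num.max (- sin 1) z).
have s1 := sin_le1 (1 : R).
have w1 : - sin 1 <= w <= sin 1.
  by rewrite /w le_min le_max lexx ge_min lexx /= andbT; have := sin1_ge0; lra.
have /andP[w1l w1r] := w1.
have w2 : - 1 <= w <= 1 by lra.
have sw : sin (asin w) = w by rewrite asinK// in_itv.
have aw : - (pi / 2) <= asin w <= pi / 2 by rewrite asin_geNpi2// asin_lepi2.
have /andP[aw1 aw2] := aw.
have p2 := pi2_ge1.
have aw' : - 1 <= asin w <= 1.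
  apply/andP; split; rewrite leNgt; apply/negP => h.
    suff : w < - sin 1 by rewrite ltNge w1l.
    by rewrite -sinN -{1}sw ltr_sin// in_itv/=; lra.
  suff : sin 1 < w by rewrite ltNge w1r.
  by rewrite -{1}sw ltr_sin// in_itv/=; lra.
apply: le_trans (sin_lipschitz_inv aw' u1) _; rewrite sw.
have su : - sin 1 <= sin u <= sin 1.
  rewrite -sinN; apply/andP; split; rewrite leNgt ltr_sin ?in_itv/= -?leNgt//; lra.
have /andP[su1 su2] := su.
rewrite /w.
case: (leP (- sin 1) z) => hz; last first.
  by rewrite min_r ?ler0_norm; lra.
by case: (leP (sin 1) z) => hz' //; rewrite ?ger0_norm; lra.
Qed.

(* On the box |x_i| <= a, f is a continuous function of s_i = (1 + sin (x_i / a)) / 2,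
   and its Bernstein polynomial in the s_i is a trigonometric polynomial in x.
   Outside the box the error is at most 2 M <= 2 M |x|^2 / a^2. *)
Lemma trig_approximation f (M a e : R) : continuous f ->
  (forall x, `|f x| <= M) -> 0 < a -> 0 < e ->
  exists2 tau, trig_poly tau & forall x,
    `|f x - tau x| <= e + 2 * M / a ^+ 2 * \sum_i x 0 i ^+ 2.
Proof.
move=> cf fM a0 e0.
have M0 : 0 <= M by apply: le_trans (normr_ge0 (f 0)) (fM 0).
have e20 : 0 < e / 2 by rewrite divr_gt0.
have [d d0 fd] := uniform_continuity_box a cf e20.
have c1 := @cos1_gt0 R.
pose s (x : 'rV[R]_m) i : R := (1 + sin (a^-1 * x 0 i)) / 2.
have s01 x i : 0 <= s x i <= 1.
  by have := sin_geN1 (a^-1 * x 0 i); have := sin_le1 (a^-1 * x 0 i); rewrite /s; lra.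
have ts i : trig_poly (s ^~ i).
  have := trig_polyM (trig_polyD (@trig_poly_cst R m 1) (@trig_poly_sin R m a^-1 i)) (@trig_poly_cst R m 2^-1).
  exact.
(* Chosen so that a deviation of at least d cos 1 / (2 a) between k_i / n and s_i has C times its
   square at least 2 M. *)
pose C := 2 * M * (2 * a / (cos 1 * d)) ^+ 2.
have C0 : 0 <= C by apply: mulr_ge0; [exact: mulr_ge0|exact: sqr_ge0].
(* The mean squared deviation is at most 1 / n in each of the m coordinates, so this n brings C
   times their sum below e / 2. *)
pose n := (Num.truncn (C * m%:R / (e / 2))).+1.
have nC : C * m%:R / n%:R <= e / 2.
  rewrite ler_pdivrMr ?ltr0n// [leRHS]mulrC -ler_pdivrMr//.
  exact/ltW/Num.Theory.truncnS_gt.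
pose F (k : 'I_m -> nat) := f (\row_i (a * clamp_asin (2 * ((k i)%:R / n%:R) - 1))).
pose k0 (i : 'I_m) := 0%N.
pose tau x := mbernstein (s x) n (enum 'I_m) F k0.
exists tau; first exact: trig_poly_mbernstein.
(* [mbernstein] is a positive operator fixing constants, so a bound on |f x - F k| for each k passes
   to the mean. *)
have diff x (g : ('I_m -> nat) -> R) : (forall k, `|f x - F k| <= g k) ->
    `|f x - tau x| <= mbernstein (s x) n (enum 'I_m) g k0.
  move=> Fg; have E : f x - tau x = mbernstein (s x) n (enum 'I_m)
      (fun k => -1 * F k + f x) k0.
    by rewrite mbernstein_lin mbernstein_cst /tau; ring.
  rewrite ler_norml E; apply/andP; split.
    have -> : - mbernstein (s x) n (enum 'I_m) g k0 =
        mbernstein (s x) n (enum 'I_m) (fun k => -1 * g k + 0) k0.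
      by rewrite mbernstein_lin mbernstein_cst; ring.
    by apply: le_mbernstein => // k _; have := Fg k; rewrite ler_norml; lra.
  by apply: le_mbernstein => // k _; have := Fg k; rewrite ler_norml; lra.
move=> x; have [xa|/existsNP[i /negP xi]] := pselect (forall i, `|x 0 i| <= a); last first.
  have B : `|f x - tau x| <= 2 * M.
    rewrite -(mbernstein_cst (s x) n (enum 'I_m) (2 * M) k0).
    apply: diff => k; apply: le_trans (ler_normB _ _) _.
    by have := fM x; have := fM (\row_i (a * clamp_asin (2 * ((k i)%:R / n%:R) - 1)));
      rewrite -/(F k); lra.
  apply: le_trans B _; rewrite -[leLHS]add0r; apply: lerD; first exact: ltW.
  rewrite -mulrA ler_peMr ?mulr_ge0//.
  rewrite (bigD1 i)//= mulrDr -[leLHS]addr0; apply: lerD.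
    rewrite mulrC ler_pdivlMr ?exprn_gt0// mul1r -(ger0_norm (ltW a0)) -[leRHS]real_normK ?num_real//.
    by rewrite ler_sqr ?nnegrE// ger0_norm ?(ltW a0)//; move: xi; rewrite -ltNge => /ltW.
  by rewrite mulr_ge0 ?invr_ge0 ?sqr_ge0// sumr_ge0// => j _; exact: sqr_ge0.
apply: (@le_trans _ _ e); last first.
  by rewrite lerDl !mulr_ge0 ?invr_ge0 ?sqr_ge0// sumr_ge0// => j _; exact: sqr_ge0.
(* Either all coordinates of y are within d of those of x and uniform continuity gives e / 2, or one
   is not and the trivial bound 2 M is absorbed by the quadratic term. *)
have key k : `|f x - F k| <= e / 2 + C * \sum_i ((k i)%:R / n%:R - s x i) ^+ 2.
  rewrite /F; set y := \row_i _.
  have yx i : `|x 0 i - y 0 i| <= 2 * a / cos 1 * `|(k i)%:R / n%:R - s x i|.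
    rewrite mxE; set z := 2 * _ - 1.
    have u1 : -1 <= a^-1 * x 0 i <= 1.
      by rewrite -ler_norml normrM normfV (gtr0_norm a0) mulrC ler_pdivrMr// mul1r.
    have := clamp_asin_lipschitz z u1.
    have -> : z - sin (a^-1 * x 0 i) = 2 * ((k i)%:R / n%:R - s x i).
      by rewrite /z /s; move: ((k i)%:R / n%:R) (sin _) => q q'; field.
    rewrite normrM ger0_norm// => H.
    have -> : x 0 i - a * clamp_asin z = - (a * (clamp_asin z - a^-1 * x 0 i)).
      by field; rewrite gt_eqF.
    rewrite normrN normrM (gtr0_norm a0).
    have -> : 2 * a / cos 1 * `|(k i)%:R / n%:R - s x i| =
      a * (2 * `|(k i)%:R / n%:R - s x i| / cos 1) by field; rewrite gt_eqF.
    by rewrite ler_pM2l// ler_pdivlMr// mulrC.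
  have sum0 : 0 <= \sum_i ((k i)%:R / n%:R - s x i) ^+ 2.
    by apply: sumr_ge0 => i _; exact: sqr_ge0.
  have [xyd|/existsNP[i /negP xyd]] := pselect (forall i, `|x 0 i - y 0 i| < d).
    apply: (@le_trans _ _ (e / 2)); first exact/ltW/fd.
    by rewrite lerDl mulr_ge0.
  apply: (@le_trans _ _ (2 * M)).
    by apply: le_trans (ler_normB _ _) _; have := fM x; have := fM y; lra.
  rewrite -[leLHS]add0r; apply: lerD; first exact: ltW.
  rewrite /C -mulrA ler_peMr ?mulr_ge0//.
  rewrite (bigD1 i)//= mulrDr -[leLHS]addr0; apply: lerD; last first.
    by rewrite mulr_ge0 ?sqr_ge0// sumr_ge0// => j _; exact: sqr_ge0.
  rewrite -exprMn -[leRHS]real_normK ?num_real// exprn_ege1//.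
  rewrite -leNgt in xyd.
  rewrite normrM [X in X * _]gtr0_norm; last by rewrite divr_gt0 ?mulr_gt0.
  have -> : 2 * a / (cos 1 * d) * `|(k i)%:R / n%:R - s x i| =
    (2 * a / cos 1 * `|(k i)%:R / n%:R - s x i|) / d by field; rewrite !gt_eqF.
  by rewrite ler_pdivlMr// mul1r (le_trans xyd).
apply: le_trans (diff x _ key) _.
rewrite (_ : (fun k => _) = (fun k : 'I_m -> nat => C * (\sum_i ((k i)%:R / n%:R - s x i) ^+ 2) + e / 2)); last first.
  by apply/funext => k; rewrite addrC.
rewrite mbernstein_lin mbernstein_cst mbernstein_sum.
rewrite [leRHS](_ : e = e / 2 + e / 2); last by field.
rewrite lerD2r; apply: le_trans nC; rewrite -mulrA ler_wpM2l//.
rewrite -[m in leRHS]card_ord -sum1_card natr_sum mulr_suml; apply: ler_sum => i _.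
by rewrite mul1r; exact: mbernstein_sqr_le.
Qed.

End trigonometric_approximation.

(** * Convergence in law *)

Section borel_row_vectors.
Context {R : realType} (m : nat).

(** An open set is the union of the balls it contains with rational center and radius 1 / (k + 1), a
    countable family; in the sup norm, the preimage of a ball is a finite intersection of conditions
    on coordinates. *)
Lemma measurable_preimage_open d (T : measurableType d) (V : T -> 'rV[R]_m)
    (A : set 'rV[R]_m) :
  (forall i, measurable_fun setT (fun w => V w 0 i)) -> open A ->
  measurable (V @^-1` A).
Proof.
move=> mV oA.
pose B (q : 'rV[rat]_m * nat) : set 'rV[R]_m :=
  ball (\row_i (ratr (q.1 0 i) : R)) q.2.+1%:R^-1.
have -> : V @^-1` A =
    \bigcup_q (if `[< B q `<=` A >] then V @^-1` B q else set0).
  apply/seteqP; split => w /=; last first.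
    by move=> [q _]; case: asboolP => // BA /BA.
  move=> AVw; have /nbhs_ballP[r /= r0 rA] : nbhs (V w) A.
    exact: open_nbhs_nbhs.
  (* Twice the radius 1 / (k + 1) is below r, so a ball of that radius containing [V w] stays within
     distance r of it. *)
  pose k := Num.truncn (2 / r).
  have k0 : 0 < k.+1%:R^-1 :> R by rewrite invr_gt0 ltr0n.
  have kr : k.+1%:R^-1 + k.+1%:R^-1 < r :> R.
    have -> : k.+1%:R^-1 + k.+1%:R^-1 = 2 / k.+1%:R :> R by ring.
    rewrite ltr_pdivrMr ?ltr0n// mulrC -ltr_pdivrMr//.
    exact: Num.Theory.truncnS_gt.
  set rho : R := k.+1%:R^-1 in k0 kr.
  have xq i : exists q : rat, V w 0 i - rho < ratr q < V w 0 i + rho.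
    have /rat_in_itvoo[q] : V w 0 i - rho < V w 0 i + rho by lra.
    by rewrite in_itv/=; exists q.
  have [q qP] := choice xq.
  exists (\row_i q i, k) => //.
  have BV : B (\row_i q i, k) (V w).
    split=> // i j; rewrite /ball/= (ord1 i) !mxE -/rho ltr_norml.
    by have /andP[] := qP j; rewrite -/(V w 0 j); lra.
  rewrite asboolT// => y By; apply: rA; apply: le_ball (ltW kr) _ _.
  exact: ball_triangle (ball_sym BV) By.
apply: countable_bigcupT_measurable => [|q]; first exact: countableP.
case: asboolP => // _.
have -> : V @^-1` B q = \bigcap_(i in [set: 'I_m])
    ((fun w => V w 0 i) @^-1` ball (ratr (q.1 0 i) : R) q.2.+1%:R^-1).
  apply/seteqP; split => w /=.
    by move=> [_ Bq] i _ /=; have := Bq 0 i; rewrite mxE.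
  move=> Bq; split; first by rewrite invr_gt0 ltr0n.
  by move=> i j; rewrite (ord1 i) mxE; exact: Bq.
apply: fin_bigcap_measurable => // i _.
by rewrite -[X in measurable X]setTI; apply: mV => //; exact: measurable_ball.
Qed.

Lemma measurable_fun_borel_rV d (T : measurableType d) (V : T -> 'rV[R]_m) :
  (forall i, measurable_fun setT (fun w => V w 0 i)) ->
  measurable_fun [set: T] (V : T -> @borel_rV R m).
Proof.
move=> mV; apply: (@measurability _ _ T (@borel_rV R m) setT V open) => //.
by move=> _ [A oA <-]; rewrite setTI; exact: measurable_preimage_open.
Qed.

Lemma continuous_measurable_rV (f : 'rV[R]_m -> R) : continuous f ->
  measurable_fun [set: @borel_rV R m] f.
Proof.
move=> /continuousP cf; apply: (measurability _ (RGenOpens.measurableE R)).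
move=> _ [_ [a [b ->]] <-]; rewrite setTI.
by apply: sub_sigma_algebra; apply: cf; exact: interval_open.
Qed.

Lemma bounded_expectation_law d (T : measurableType d) (P : probability T R)
    (V : T -> 'rV[R]_m) : (forall i, measurable_fun setT (fun w => V w 0 i)) ->
  exists mu : probability (@borel_rV R m) R, forall f, continuous f ->
    (exists M, forall v, `|f v| <= M) -> ('E_mu[f] = 'E_P[f \o V])%E.
Proof.
move=> mV; have mV' := measurable_fun_borel_rV mV.
pose W : {mfun T >-> @borel_rV R m} := HB.pack (V : T -> @borel_rV R m)
  (isMeasurableFun.Build _ _ _ _ _ mV').
exists (distribution P W) => f cf [M fM].
have mf := continuous_measurable_rV cf.
rewrite unlock integral_distribution//; first exact/measurable_EFinP.
apply: (@integrable_boundedR _ _ _ P _ M) => //.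
  exact: measurableT_comp mf mV'.
Qed.

End borel_row_vectors.

Section levy_continuity.
Context {R : realType} (m : nat).
Implicit Types f tau : 'rV[R]_m -> R.

Let measurable_lincomb d (T : measurableType d) (V : T -> 'rV[R]_m)
    (t : 'I_m -> R) (c : R) : (forall i, measurable_fun setT (fun w => V w 0 i)) ->
  measurable_fun setT (fun w => \sum_i t i * V w 0 i + c).
Proof.
move=> mV; apply: measurable_funD; last exact: measurable_cst.
by apply: measurable_sum => i; apply: measurable_funM; [exact: measurable_cst|exact: mV].
Qed.

Let integrable_trig_poly d (T : measurableType d) (P : probability T R)
    (V : T -> 'rV[R]_m) tau :
  (forall i, measurable_fun setT (fun w => V w 0 i)) -> trig_poly tau ->
  P.-integrable [set: T] (EFin \o (fun w => tau (V w))).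
Proof.
move=> mV [s sE]; under [X in EFin \o X]eq_fun do rewrite sE.
apply: integrable_sumR => q; apply: integrable_scaleR.
by apply: integrable_cos; exact: measurable_lincomb.
Qed.

Let trig_poly_mean_dist d (T : measurableType d) (P : probability T R)
    (V : T -> 'rV[R]_m) f tau (M e b : R) :
  (forall i, measurable_fun setT (fun w => V w 0 i)) ->
  (forall i, P.-integrable [set: T] (EFin \o (fun w => V w 0 i ^+ 2))) ->
  continuous f -> (forall x, `|f x| <= M) -> trig_poly tau ->
  (forall x, `|f x - tau x| <= e + b * \sum_i x 0 i ^+ 2) ->
  `|\int[P]_w f (V w) - \int[P]_w tau (V w)| <=
    e + b * \sum_i \int[P]_w (V w 0 i ^+ 2).
Proof.
move=> mV iV cf fM ttau ftau.
have mf : measurable_fun setT (fun w => f (V w)).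
  exact: measurableT_comp (continuous_measurable_rV cf) (measurable_fun_borel_rV mV).
have intf := integrable_boundedR P mf (fun w => fM (V w)).
have inttau := integrable_trig_poly P mV ttau.
have ie : P.-integrable [set: T] (EFin \o (fun=> e)).
  by apply: (@integrable_boundedR _ _ _ _ _ `|e|).
have isum := integrable_sumR (index_enum 'I_m) iV.
rewrite -RintegralB//.
rewrite -[X in _ <= X + _](Rintegral_cstR P e) -Rintegral_sumR// -RintegralZl//.
rewrite -RintegralD//; last exact: integrable_scaleR.
apply: normr_Rintegral_le => //.
- by apply: measurable_funB => //; exact: integrable_measurable inttau.
- by apply: integrable_addR => //; exact: integrable_scaleR.
Qed.

Context d (T : measurableType d) (P : probability T R) (V : nat -> T -> 'rV[R]_m).
Context d' (T' : measurableType d') (P' : probability T' R) (W : T' -> 'rV[R]_m).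
Hypothesis mV : forall n i, measurable_fun setT (fun w => V n w 0 i).
Hypothesis iV : forall n i,
  P.-integrable [set: T] (EFin \o (fun w => V n w 0 i ^+ 2)).
Variable v : 'I_m -> R.
Hypothesis Vv : forall n i, \int[P]_w (V n w 0 i ^+ 2) <= v i.
Hypothesis mW : forall i, measurable_fun setT (fun w => W w 0 i).
Hypothesis iW : forall i,
  P'.-integrable [set: T'] (EFin \o (fun w => W w 0 i ^+ 2)).
Hypothesis cvg_cos_mean : forall t : 'I_m -> R,
  (fun n => \int[P]_w cos (\sum_i t i * V n w 0 i)) @ \oo -->
  \int[P']_w cos (\sum_i t i * W w 0 i).
Hypothesis cvg_sin_mean : forall t : 'I_m -> R,
  (fun n => \int[P]_w sin (\sum_i t i * V n w 0 i)) @ \oo -->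
  \int[P']_w sin (\sum_i t i * W w 0 i).

Let trig_poly_meanE e (S : measurableType e) (Q : probability S R)
    (Z : S -> 'rV[R]_m) (s : seq (R * ('I_m -> R) * R)) :
  (forall i, measurable_fun setT (fun w => Z w 0 i)) ->
  \int[Q]_w (\sum_(q <- s) q.1.1 * cos (\sum_i q.1.2 i * Z w 0 i + q.2)) =
  \sum_(q <- s) q.1.1 *
    (cos q.2 * \int[Q]_w cos (\sum_i q.1.2 i * Z w 0 i) +
     (- sin q.2) * \int[Q]_w sin (\sum_i q.1.2 i * Z w 0 i)).
Proof.
move=> mZ.
have ml (t : 'I_m -> R) : measurable_fun setT (fun w => \sum_i t i * Z w 0 i).
  by have := measurable_lincomb t 0 mZ; under eq_fun do rewrite addr0.
rewrite Rintegral_sumR; last first.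
  by move=> q; apply/integrable_scaleR/integrable_cos; exact: measurable_lincomb.
apply: eq_bigr => q _; rewrite RintegralZl//; last first.
  by apply: integrable_cos; exact: measurable_lincomb.
have ic := integrable_cos Q (ml q.1.2); have is_ := integrable_sin Q (ml q.1.2).
rewrite -(RintegralZl (cos q.2) measurableT ic) -(RintegralZl _ measurableT is_).
rewrite -RintegralD//; [|exact: integrable_scaleR..].
by congr (_ * _); apply: eq_Rintegral => w _; rewrite cosD; ring.
Qed.

Let cvg_trig_poly_mean tau : trig_poly tau ->
  (fun n => \int[P]_w tau (V n w)) @ \oo --> \int[P']_w tau (W w).
Proof.
move=> [s sE].
have E e (S : measurableType e) (Q : probability S R) (Z : S -> 'rV[R]_m) :
    \int[Q]_w tau (Z w) =
    \int[Q]_w (\sum_(q <- s) q.1.1 * cos (\sum_i q.1.2 i * Z w 0 i + q.2)).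
  by apply: eq_Rintegral => w _; exact: sE.
rewrite E trig_poly_meanE//.
have -> : (fun n => \int[P]_w tau (V n w)) = (fun n => \sum_(q <- s) q.1.1 *
    (cos q.2 * \int[P]_w cos (\sum_i q.1.2 i * V n w 0 i) +
     (- sin q.2) * \int[P]_w sin (\sum_i q.1.2 i * V n w 0 i))).
  by apply/funext => n; rewrite E trig_poly_meanE.
elim: s {sE E} => [|q s ih].
  by under eq_fun do rewrite big_nil; rewrite big_nil; exact: cvg_cst.
under eq_fun do rewrite big_cons; rewrite big_cons.
apply: cvgD => //; apply: cvgMr.
by apply: cvgD; apply: cvgMr; [exact: cvg_cos_mean|exact: cvg_sin_mean].
Qed.

Lemma cvg_mean_of_char_function f M : continuous f -> (forall x, `|f x| <= M) ->
  (fun n => \int[P]_w f (V n w)) @ \oo --> \int[P']_w f (W w).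
Proof.
move=> cf fM; apply/cvgrPdist_lt => eps eps0.
have M0 : 0 <= M by apply: le_trans (normr_ge0 (f 0)) (fM 0).
(* Two parts for replacing f by tau under each of the two laws, and one for the convergence of the
   means of tau. *)
pose e := eps / 5; have e0 : 0 < e by rewrite divr_gt0.
pose v' i := \int[P']_w (W w 0 i ^+ 2).
have v'0 : 0 <= \sum_i v' i.
  by apply: sumr_ge0 => i _; apply: Rintegral_ge0 => w _; exact: sqr_ge0.
have v0 : 0 <= \sum_i v i.
  apply: sumr_ge0 => i _; apply: le_trans (Vv 0%N i).
  by apply: Rintegral_ge0 => w _; exact: sqr_ge0.
pose k := 2 * M * (\sum_i v i + \sum_i v' i).
have k0 : 0 <= k by rewrite mulr_ge0 ?mulr_ge0 ?addr_ge0.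
(* Then k / a^2 <= e, because k <= e a and a >= 1; this a depends neither on n nor on tau. *)
pose a := 1 + k / e; have a1 : 1 <= a by rewrite lerDl divr_ge0// ltW.
have a0 : 0 < a by lra.
pose b := 2 * M / a ^+ 2.
have b0 : 0 <= b by apply: divr_ge0; [exact: mulr_ge0|exact: sqr_ge0].
have be : b * (\sum_i v i + \sum_i v' i) <= e.
  have -> : b * (\sum_i v i + \sum_i v' i) = k / a ^+ 2 by rewrite /b /k; ring.
  rewrite ler_pdivrMr ?exprn_gt0//.
  have ka : k <= e * a by rewrite /a mulrDr mulrCA divff ?gt_eqF//; lra.
  by apply: le_trans ka _; rewrite ler_pM2l// expr2 ler_peMr// ltW.
have bv : b * (\sum_i v i) <= e.
  by apply: le_trans be; rewrite ler_wpM2l// lerDl.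
have bv' : b * (\sum_i v' i) <= e.
  by apply: le_trans be; rewrite ler_wpM2l// lerDr.
have [tau ttau ftau] := trig_approximation cf fM a0 e0.
have gW := trig_poly_mean_dist mW iW cf fM ttau ftau.
have gV n : `|\int[P]_w f (V n w) - \int[P]_w tau (V n w)| <= e + e.
  apply: le_trans (trig_poly_mean_dist (mV n) (iV n) cf fM ttau ftau) _.
  rewrite lerD2l; apply: le_trans bv; rewrite ler_wpM2l//.
  by apply: ler_sum => i _; exact: Vv.
have /cvgrPdist_lt/(_ _ e0) := cvg_trig_poly_mean ttau.
apply: filterS => n gtau; rewrite -/b -/(\sum_i v' i) in gW.
have := gV n; move: gtau gW.
rewrite ltr_norml !ler_norml ltr_norml /e in bv' *.
lra.
Qed.

End levy_continuity.

(** * Gaussian limits of empirical vectors *)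

Section central_limit.
Context {R : realType} (Q : probability (measurableTypeR R) R).
Context (m : nat) (h : 'I_m -> R -> R).
Hypothesis hQ : forall i, L2 Q (h i).

(** [empirical] subtracts the mean, so it sees h only through this function, to which the estimates
    for mean zero apply. *)
Definition centered (h : R -> R) x := h x - inner Q h (cst 1).

Lemma centered_L2 (k : R -> R) : L2 Q k -> L2_centered Q (centered k).
Proof.
move=> kQ; split; first exact: L2B kQ (L2_cst _ _).
rewrite (innerBl kQ (L2_cst Q (inner Q k (cst 1))) (L2_cst Q 1)).
have -> : cst (inner Q k (cst 1)) = (fun x => inner Q k (cst 1) * cst 1 x) :> (R -> R).
  by apply/funext => x; rewrite mulr1.
by rewrite innerZl ?inner11 ?mulr1 ?subrr//; exact: L2_cst.
Qed.

Lemma inner_centered (k k' : R -> R) : L2 Q k -> L2 Q k' ->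
  inner Q (centered k) (centered k') =
  inner Q k k' - inner Q k (cst 1) * inner Q k' (cst 1).
Proof.
move=> kQ k'Q; have [_ k0] := centered_L2 kQ; have [kc _] := centered_L2 kQ.
have E : (cst (inner Q k' (cst 1)) : R -> R) =
    (fun x => inner Q k' (cst 1) * cst 1 x) :> (R -> R).
  by apply/funext => x; rewrite mulr1.
rewrite [LHS](innerBr k'Q (L2_cst Q (inner Q k' (cst 1))) kc) E.
rewrite (innerZr _ (L2_cst Q 1) kc) k0 mulr0 subr0.
rewrite (innerBl kQ (L2_cst Q (inner Q k (cst 1))) k'Q).
have -> : (cst (inner Q k (cst 1)) : R -> R) =
    (fun x => inner Q k (cst 1) * cst 1 x) :> (R -> R).
  by apply/funext => x; rewrite mulr1.
by rewrite (innerZl _ (L2_cst Q 1) k'Q) (innerC Q (cst 1)).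
Qed.

Definition covariance_mx i j := inner Q (centered (h i)) (centered (h j)).

Let comb (t : 'I_m -> R) x := \sum_i t i * centered (h i) x.

Let comb_L2 t : L2_centered Q (comb t).
Proof.
have hcQ i : L2 Q (fun x => t i * centered (h i) x).
  by apply: L2Z; exact: (centered_L2 (hQ i)).1.
split; first exact: L2_sum.
rewrite inner_suml//; last exact: L2_cst.
rewrite big1// => i _; have [ci0 ci1] := centered_L2 (hQ i).
by rewrite innerZl ?ci1 ?mulr0//; exact: L2_cst.
Qed.

(** The form is the variance of [comb t]: it is nonnegative, and it is the variance in the
    one-dimensional limit for [comb t]. *)
Lemma covariance_form (t : 'I_m -> R) :
  \sum_i t i * (\sum_j covariance_mx i j * t j) = inner Q (comb t) (comb t).
Proof.
have cQ i : L2 Q (centered (h i)) := (centered_L2 (hQ i)).1.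
have hcQ i : L2 Q (fun x => t i * centered (h i) x) := L2Z _ (cQ i).
rewrite inner_suml//; last exact: (comb_L2 t).1.
apply: eq_bigr => i _; rewrite innerZl//; last exact: (comb_L2 t).1.
rewrite innerC inner_suml//; congr (_ * _); apply: eq_bigr => j _.
by rewrite innerZl// innerC mulrC.
Qed.

Context d (T : measurableType d) (P : probability T R).
Variable Xs : nat -> {RV P >-> R}.
Hypothesis iidX : iid Xs Q.

Let V n w : 'rV[R]_m := \row_i empirical Q (fun k => Xs k) (h i) n w.

Let VE n w i : V n w 0 i =
  (Num.sqrt n%:R)^-1 * \sum_(k < n) centered (h i) (Xs k w).
Proof.
rewrite mxE /empirical; congr (_ * _); apply: eq_bigr => k _; congr (_ - _).
by rewrite unlock /inner /Rintegral; under [in RHS]eq_integral do rewrite mulr1.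
Qed.

Let mV n i : measurable_fun setT (fun w => V n w 0 i).
Proof.
under eq_fun do rewrite VE.
apply: measurable_funM; first exact: measurable_cst.
apply: measurable_sum => k.
exact: measurableT_comp (L2_measurable (centered_L2 (hQ i)).1) _.
Qed.

Let V_sqr n i : P.-integrable [set: T] (EFin \o (fun w => V n w 0 i ^+ 2)) /\
  \int[P]_w (V n w 0 i ^+ 2) <= covariance_mx i i.
Proof.
have [iS ES] := iid_sum_sqr iidX n (centered_L2 (hQ i)).
have E : (fun w => V n w 0 i ^+ 2) = (fun w => (n%:R)^-1 *
    (\sum_(k < n) centered (h i) (Xs k w)) ^+ 2).
  by apply/funext => w; rewrite VE exprMn exprVn sqr_sqrtr.
rewrite E; split; first exact: integrable_scaleR.
rewrite RintegralZl// ES mulrA /covariance_mx.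
(* At n = 0 the vector is 0, whence an inequality in place of an equality. *)
case: n {iS ES E} => [|n]; first by rewrite mulr0 mul0r; exact: inner_ge0.
by rewrite mulVf ?mul1r// pnatr_eq0.
Qed.

Context d' (T' : measurableType d') (P' : probability T' R) (W : 'I_m -> T' -> R).
Hypothesis mW : forall i, measurable_fun [set: T'] (W i).
Hypothesis iW : forall i, P'.-integrable [set: T'] (EFin \o (fun w => W i w ^+ 2)).
Hypothesis charW : forall t : 'I_m -> R,
  \int[P']_w cos (\sum_i t i * W i w) =
    expR (- ((\sum_i t i * (\sum_j covariance_mx i j * t j)) / 2)) /\
  \int[P']_w sin (\sum_i t i * W i w) = 0.

(** The scalar product t . V_n is the normalized sum of [comb t] over the sample, so [rotation_clt]
    gives the limit of the characteristic function at every t. *)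
Lemma empirical_cvg_in_law (mu : probability (@borel_rV R m) R) :
  (forall f, continuous f -> (exists M, forall v, `|f v| <= M) ->
    ('E_mu[f] = 'E_P'[f \o (fun w => \row_i W i w)])%E) ->
  cvg_in_law P V mu.
Proof.
move=> muE f cf fb; rewrite muE//; case: fb => M fM.
pose W' w : 'rV[R]_m := \row_i W i w.
have W'E i : (fun w => W' w 0 i) = W i by apply/funext => w; rewrite mxE.
have sumW t w : \sum_i t i * W' w 0 i = \sum_i t i * W i w.
  by apply: eq_bigr => i _; rewrite mxE.
have mW' i : measurable_fun setT (fun w => W' w 0 i) by rewrite W'E.
have iW' i : P'.-integrable [set: T'] (EFin \o (fun w => W' w 0 i ^+ 2)).
  by under [X in EFin \o X]eq_fun do rewrite mxE.
have sumV t n w : \sum_i t i * V n w 0 i =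
    \sum_(k < n) (comb t (Xs k w) / Num.sqrt n%:R).
  under eq_bigr do rewrite VE mulr_sumr mulr_sumr.
  rewrite exchange_big/=; apply: eq_bigr => k _; rewrite /comb mulr_suml.
  by apply: eq_bigr => i _; ring.
have charV t := rotation_clt (comb_L2 t).
have mth t n : measurable_fun [set: R] (fun x => comb t x / Num.sqrt n%:R).
  by apply: measurable_funM => //; exact: L2_measurable (comb_L2 t).1.
have eqc (u v : nat -> R) r : u =1 v -> u @ \oo --> r -> v @ \oo --> r.
  by move=> /funext ->.
have cosV t : (fun n => \int[P]_w cos (\sum_i t i * V n w 0 i)) @ \oo -->
    \int[P']_w cos (\sum_i t i * W' w 0 i).
  under eq_Rintegral do rewrite sumW.
  rewrite (charW t).1 covariance_form; have [+ _] := charV t.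
  apply: eqc => n; rewrite -(iid_cos_sin_sum iidX n (mth t n)).1.
  by apply: eq_Rintegral => w _; rewrite sumV.
have sinV t : (fun n => \int[P]_w sin (\sum_i t i * V n w 0 i)) @ \oo -->
    \int[P']_w sin (\sum_i t i * W' w 0 i).
  under eq_Rintegral do rewrite sumW.
  rewrite (charW t).2; have [_ +] := charV t.
  apply: eqc => n; rewrite -(iid_cos_sin_sum iidX n (mth t n)).2.
  by apply: eq_Rintegral => w _; rewrite sumV.
have := cvg_mean_of_char_function mV (fun n i => (V_sqr n i).1)
  (fun n i => (V_sqr n i).2) mW' iW' cosV sinV cf fM.
have EE e (S : measurableType e) (N : probability S R) (Z : S -> 'rV[R]_m) :
    (forall i, measurable_fun setT (fun w => Z w 0 i)) ->
    ('E_N[f \o Z] = (\int[N]_w f (Z w))%:E)%E.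
  move=> mZ; rewrite unlock EFin_Rintegral//.
  apply: (@integrable_boundedR _ _ _ N _ M) => [|x]; last exact: fM.
  exact: measurableT_comp (continuous_measurable_rV cf) (measurable_fun_borel_rV mZ).
rewrite (EE _ _ _ W')// => cf'.
have -> : (fun n => 'E_P[f \o V n]%E) = (fun n => (\int[P]_w f (V n w))%:E).
  by apply/funext => n; rewrite EE.
by apply: cvg_EFin; [exact: nearW|exact: cf'].
Qed.

End central_limit.

(** The limit depends only on the covariance matrix: one Gaussian vector built from it serves both
    processes, whatever the spaces carrying the samples. *)
Lemma same_limiting_fidi_of_covariance {R : realType}
    (Q1 Q2 : probability (measurableTypeR R) R) (h phi : nat -> R -> R) :
  (forall j, L2 Q1 (h j)) -> (forall j, L2 Q2 (phi j)) ->
  (forall i j, inner Q1 (centered Q1 (h i)) (centered Q1 (h j)) =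
               inner Q2 (centered Q2 (phi i)) (centered Q2 (phi j))) ->
  same_limiting_fidi Q1 Q2 h phi.
Proof.
move=> hL phiL cov d1 d2 T1 T2 P1 P2 Xs Ys iidX iidY m J.
pose A := covariance_mx Q2 (fun i : 'I_m => phi (J i)).
have phiJ (i : 'I_m) := phiL (J i); have hJ (i : 'I_m) := hL (J i).
have AE : covariance_mx Q1 (fun i : 'I_m => h (J i)) = A.
  by apply/funext => i; apply/funext => j; exact: cov.
have [|t|s sE] := @psd_sum_of_squares R m A.
- by move=> i j; exact: innerC.
- by rewrite covariance_form//; exact: inner_ge0.
have [d' [T' [P' [W [mW iW charW]]]]] := gaussian_vector_exists s.
have [|mu muE] := bounded_expectation_law P' (V := fun w => \row_i W i w).
  by move=> i; under eq_fun do rewrite mxE; exact: mW.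
exists mu; split.
- by apply: (empirical_cvg_in_law hJ iidX mW iW) => // t; rewrite AE sE.
- by apply: (empirical_cvg_in_law phiJ iidY mW iW) => // t; rewrite sE.
Qed.

Unset Implicit Arguments.

(** The elements of a basis of all of L^2(F) cannot all be centered, since 1 would be orthogonal to
    each of them. Hence the two readings, basis of L^2 or of its centered subspace; the limit
    statement holds under either. *)
Theorem proposition5 (R : realType) (p : nat) (hp : (0 < p)%N) (X : set R)
    (G F : probability (measurableTypeR R) R)
    (g f : 'rV[R]_p -> R -> R) (beta gamma : 'rV[R]_p)
    (hG : regular_model G X g beta) (hF : regular_model F X f gamma)
    (SG SF : 'M[R]_p)
    (hSG : principal_sqrt (invmx (gram G (score X g beta))) SG)
    (hSF : principal_sqrt (invmx (gram F (score X f gamma))) SF)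
    (phi : nat -> R -> R) :
  let b := mx_lincomb SG (score X g beta) in
  let a := mx_lincomb SF (score X f gamma) in
  let l := lfun X (f gamma) (g beta) in
  let c := fun k => K G l (fun x => l x * a k x) in
  let UKl := fun zeta : R -> R => U_all G b c (K G l (fun x => l x * zeta x)) in
  let phit := fun (j : nat) (x : R) =>
    phi j x - \sum_(k < p) a k x * inner F (a k) (phi j) in
  let h := fun j => UKl (phi j) in
  let ht := fun j => UKl (phit j) in
  [/\ orthonormal_basis F (L2 F) phi -> orthonormal_basis G (L2 G) h,
      orthonormal_basis F (L2_centered F) phi ->
        orthonormal_basis G (L2_centered G) h
    & orthonormal_basis F (L2 F) phi \/
      orthonormal_basis F (L2_centered F) phi ->
        same_limiting_fidi G F ht phit].
Proof.
move=> b a l c UKl phit h ht.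
have [dG _ uG gG] := hG; have [dF _ uF gF] := hF.
have bC k : L2_centered G (b k) := mx_lincomb_centered SG uG k.
have aC k : L2_centered F (a k) := mx_lincomb_centered SF uF k.
have b1 k : inner G (b k) (b k) = 1.
  by rewrite (mx_lincomb_orthonormal uG gG hSG) eqxx.
have a1 k : inner F (a k) (a k) = 1.
  by rewrite (mx_lincomb_orthonormal uF gF hSF) eqxx.
have unitT : L2_unitary F G UKl := transfer_unitary dG dF bC b1 aC a1.
have meanT zeta : L2 F zeta -> inner G (UKl zeta) (cst 1) = inner F zeta (cst 1).
  exact: (transfer_mean dG dF bC b1 aC a1).
have [[TG _ iT] _] := unitT.
split; [exact: onb_unitary_L2|exact: onb_unitary_centered|move=> onb].
have phiL j : L2 F (phi j).
  by case: onb => -[+ _ _] => /(_ j) //; case.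
have phitL j : L2 F (phit j).
  apply: L2B (phiL j) _; apply: L2_sum => k.
  have := L2Z (inner F (a k) (phi j)) (aC k).1.
  by under eq_fun do rewrite mulrC.
apply: same_limiting_fidi_of_covariance => // [j|i j]; first exact: TG.
have GL k : L2 G (ht k) by exact: TG.
(* Covariances are expressed by inner products and means, both preserved by [UKl]. *)
rewrite (inner_centered (GL i) (GL j)) (inner_centered (phitL i) (phitL j)).
by congr (_ - _ * _); [exact: iT|exact: meanT|exact: meanT].
Qed.
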